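(* For a full-dimensional centrally symmetric polytope $P$ and a point $a$ of its ambient space, let $N_P(a)$ denote the number of maximal cells of $\operatorname{bis}^P(0,a)$. Let $a$ be a generic point, i.e. a point in general position with respect to the polytope under consideration. Then: (1) $N_{P_{2n}}(a)=2n-1$ for every centrally symmetric polygon $P_{2n}\subset\mathbb{R}^2$ with $2n$ vertices; (2) $N_{C_d}(a)=d^2-d+1$, where $C_d=[-1,1]^d\subset\mathbb{R}^d$; (3) $N_{\diamond_d}(a)=\Omega(2^d)$, where $\diamond_d=\operatorname{conv}\{\pm e_i:i\in[d]\}\subset\mathbb{R}^d$; (4) $N_{Q_d}(a)=\Omega(2^d)$, where $Q_d=\operatorname{conv}\{e_i-e_j:1\le i\neq j\le d\}$ is regarded as a full-dimensional polytope in $H=\{x\in\mathbb{R}^d:\sum_i x_i=0\}$ and $a\in H$.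
   Context: Let $P=-P$ be a full-dimensional convex polytope in a real vector space $V$ ($V=\mathbb{R}^2$ in (1), $\mathbb{R}^d$ in (2),(3), $H$ in (4)). $\operatorname{dist}^P(a,b)=\min\{\alpha\ge0:b-a\in\alpha P\}$ and $\operatorname{bis}^P(a,b)=\{x\in V:\operatorname{dist}^P(a,x)=\operatorname{dist}^P(b,x)\}$. For a face $F$ of $P$, $C_F=\operatorname{cone}(F)$. $\operatorname{bis}^P(a,b)$ is a polyhedral complex whose cells are $\operatorname{bis}^P_{F,G}(a,b)=\operatorname{bis}^P(a,b)\cap(C_F+a)\cap(C_G+b)$ for faces $F,G$ of $P$. Bisectors $\operatorname{bis}^P(a,b)$ and $\operatorname{bis}^P(a',b')$ are equivalent if for all facets $F,G$: $\operatorname{bis}^P_{F,G}(a,b)\neq\emptyset\Leftrightarrow\operatorname{bis}^P_{F,G}(a',b')\neq\emptyset$. A point $c\in V$ is in general position if there is a neighborhood $U$ of $c$ in $V$ such that $\operatorname{bis}^P(0,c)$ is equivalent to $\operatorname{bis}^P(0,c')$ for all $c'\in U$. For $a$ in general position, $N_P(a)$ equals the number of ordered pairs $(F,G)$ of distinct facets of $P$ with $\operatorname{bis}^P_{F,G}(0,a)\ne\emptyset$. $\Omega(2^d)$ means bounded below by $c\,2^d$ for a constant $c>0$ independent of $d$ and $a$, for all sufficiently large $d$. *)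

(* Defs.v *)
From HB Require Import structures.
From mathcomp Require Import all_boot all_order all_algebra finmap.
From mathcomp Require Import all_classical all_reals topology normedtype.

Set Implicit Arguments.
Unset Strict Implicit.
Unset Printing Implicit Defensive.

Import Order.TTheory GRing.Theory Num.Theory.
Import numFieldNormedType.Exports.

Local Open Scope classical_set_scope.
Local Open Scope ring_scope.

(* The ambient space V is a linear subspace of R^d, given as a set of row
   vectors; neighbourhoods in V are traces of neighbourhoods in R^d. *)

Section Polytopes.
Context {R : realType} {d : nat}.
Implicit Types (A F G P V : set 'rV[R]_d) (a b c x : 'rV[R]_d).

Definition conv A : set 'rV[R]_d :=
  [set x | exists n (p : 'I_n -> 'rV[R]_d) (w : 'I_n -> R),
    [/\ forall i, A (p i), forall i, 0 <= w i, \sum_i w i = 1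
      & x = \sum_i w i *: p i]].

Definition cone A : set 'rV[R]_d :=
  [set x | exists n (p : 'I_n -> 'rV[R]_d) (w : 'I_n -> R),
    [/\ forall i, A (p i), forall i, 0 <= w i & x = \sum_i w i *: p i]].

Definition polytope P := exists2 A, finite_set A & P = conv A.

Definition centrally_symmetric P := [set - x | x in P] = P.

Definition aff_independent k (p : 'I_k.+1 -> 'rV[R]_d) :=
  row_free (\matrix_(i < k) (p (lift ord0 i) - p ord0)).

(* Affine dimension; the empty set gets dimension 0 rather than -1. *)
Definition affdim A : nat :=
  \max_(k < d.+1 |
     `[< exists p : 'I_k.+1 -> 'rV[R]_d,
           (forall i, A (p i)) /\ aff_independent p >]) k.

(* Nonempty faces, P itself included (u = 0). *)
Definition face P F := exists u : 'cV[R]_d,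
  F = [set x | P x /\ forall y, P y -> (y *m u) 0 0 <= (x *m u) 0 0].

Definition proper_face P F := face P F /\ F <> P.

Definition facet P F := face P F /\ (affdim F).+1 = affdim P.

Definition vertex P x := face P [set x].

Definition number_of (T : choiceType) (S : set T) : nat := #|` fset_set S|.

(* The infimum is a minimum when P is a polytope with 0 in its relative
   interior and b - a in its linear span. *)
Definition dist P a b : R :=
  inf [set t : R | 0 <= t /\ [set t *: p | p in P] (b - a)].

Definition bis V P a b : set 'rV[R]_d :=
  [set x | V x /\ dist P a x = dist P b x].

Definition bis_cell V P F G a b : set 'rV[R]_d :=
  bis V P a b `&` [set x + a | x in cone F] `&` [set x + b | x in cone G].

(* Only proper faces give cells: the cone of P itself is all of V. *)
Definition cells V P a b : set (set 'rV[R]_d) :=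
  [set C | exists F G,
    [/\ proper_face P F, proper_face P G & C = bis_cell V P F G a b]].

Definition maximal_cells V P a b : set (set 'rV[R]_d) :=
  [set C | cells V P a b C /\
    forall C', cells V P a b C' -> C `<=` C' -> C' = C].

Definition bis_equiv V P a b a' b' := forall F G, facet P F -> facet P G ->
  bis_cell V P F G a b !=set0 <-> bis_cell V P F G a' b' !=set0.

Definition general_position V P c :=
  \forall c' \near within V (nbhs c), bis_equiv V P 0 c 0 c'.

Definition N V P a : nat := number_of (maximal_cells V P 0 a).

End Polytopes.

Section Families.
Context (R : realType) (d : nat).

Definition cube : set 'rV[R]_d := [set x | forall i, -1 <= x 0 i <= 1].

Definition stdb (i : 'I_d) : 'rV[R]_d := delta_mx 0 i.

Definition cross_polytope : set 'rV[R]_d :=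
  conv [set x | exists i, x = stdb i \/ x = - stdb i].

Definition sum0_hyperplane : set 'rV[R]_d := [set x | \sum_i x 0 i = 0].

Definition root_polytope : set 'rV[R]_d :=
  conv [set x | exists i j, i <> j /\ x = stdb i - stdb j].

End Families.

Arguments cube R d : clear implicits.
Arguments cross_polytope R d : clear implicits.
Arguments sum0_hyperplane R d : clear implicits.
Arguments root_polytope R d : clear implicits.

(* Main.v *)
(** Since the distance from the centre to a point of the cone over a proper face
    [F] is the dilation factor, a point of the cell of [(F, G)] is [t *: p] with
    [p] in [F], [q] in [G] and [t *: (p - q) = a]: cells correspond to pairs of
    faces met successively by lines parallel to [a].
    For polygons these lines are parametrized by the heights of a linear form
    vanishing on [a]; general position makes the heights of the [2n] vertices
    distinct, and the maximal cells are the [2n - 1] gaps between them.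
    For the cube general position makes the coordinates of [a] nonzero with a
    unique one, say of index [m], of largest modulus; the exit facet [i] and
    the entry facet [j] can then be prescribed at will if [i <> j], while
    [i = j] occurs only for [i = m].
    For the last two polytopes each facet whose functional is nonnegative at [a]
    contains, in the interior of its cone, a bisector point; distinct facets
    give distinct maximal cells, and half of the facets qualify. *)

Require Import Defs.
From HB Require Import structures.
From mathcomp Require Import all_boot all_order all_algebra finmap.
From mathcomp Require Import all_classical all_reals topology normedtype.
From mathcomp Require Import ring lra.

Import Order.TTheory GRing.Theory Num.Theory.
Import numFieldNormedType.Exports.
Local Open Scope classical_set_scope.
Local Open Scope ring_scope.

(** * Faces, distances and cells *)

Section Functionals.
Set Implicit Arguments.
Unset Strict Implicit.
Unset Printing Implicit Defensive.
Context {R : realType} {d : nat}.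
Implicit Types (x y p q : 'rV[R]_d) (u w : 'cV[R]_d) (P F G V : set 'rV[R]_d).

(** [N] counts sets, not pairs of faces: cells come from all pairs of proper faces, different pairs
    may give the same set, and some cells are empty. So cells are never computed. A family of them
    is shown to dominate all others, and its members are told apart by points: a private point in
    each when the number is exact, points no two of which share a cell when only a lower bound is
    sought.

    General position says only that the set of facet pairs with nonempty cell is locally constant.
    The facts used (nonzero coordinates, a unique largest one, distinct heights) are extracted by
    contradiction: in a degenerate position [a] lies on the boundary of the cone over [F - G] for
    suitable facets [F], [G], and a small step in a well-chosen direction leaves that cone, emptying
    a cell that was nonempty at [a].

    The last two bounds count facets, [2 ^ d] sign vectors and [2 ^ d - 2] proper nonempty subsets;
    central symmetry pairs each facet functional with its opposite, and one of the two is
    nonnegative at [a]. *)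

Fact ip_key : unit. Proof. exact: tt. Qed.
(* Locked: unification would otherwise unfold the matrix product. *)
Definition ip x u : R := locked_with ip_key ((x *m u) 0 0).

Lemma ipmx x u : (x *m u) 0 0 = ip x u.
Proof. by rewrite /ip unlock. Qed.

Lemma ipDl x y u : ip (x + y) u = ip x u + ip y u.
Proof. by rewrite -!ipmx mulmxDl mxE. Qed.

Lemma ipNl x u : ip (- x) u = - ip x u.
Proof. by rewrite -!ipmx mulNmx mxE. Qed.

Lemma ipZl t x u : ip (t *: x) u = t * ip x u.
Proof. by rewrite -!ipmx -scalemxAl mxE. Qed.

Lemma ip0l u : ip 0 u = 0.
Proof. by rewrite -!ipmx mul0mx mxE. Qed.

Lemma ipDr x u w : ip x (u + w) = ip x u + ip x w.
Proof. by rewrite -!ipmx mulmxDr mxE. Qed.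

Lemma ipNr x u : ip x (- u) = - ip x u.
Proof. by rewrite -!ipmx mulmxN mxE. Qed.

Lemma ipZr t x u : ip x (t *: u) = t * ip x u.
Proof. by rewrite -!ipmx -scalemxAr mxE. Qed.

Lemma ip_suml (I : Type) (r : seq I) (Q : pred I) (f : I -> 'rV[R]_d) u :
  ip (\sum_(i <- r | Q i) f i) u = \sum_(i <- r | Q i) ip (f i) u.
Proof.
by rewrite -!ipmx mulmx_suml summxE; apply: eq_bigr => i _; rewrite ipmx.
Qed.

Lemma ipE x u : ip x u = \sum_i x 0 i * u i 0.
Proof. by rewrite -ipmx mxE. Qed.

Definition ipl := (ipDl, ipNl, ipZl, ip0l).
Definition ipr := (ipDr, ipNr, ipZr).

Definition segment_closed F := forall x y t, F x -> F y -> 0 <= t <= 1 ->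
  F (t *: x + (1 - t) *: y).

(** The weights are not normalized, so that total weight 0 is allowed; any point of [F] then serves
    as [q]. *)
Lemma segment_closed_sum (I : Type) (r : seq I) (c : I -> R)
    (p : I -> 'rV[R]_d) F :
  segment_closed F -> F !=set0 -> (forall i, 0 <= c i) -> (forall i, F (p i)) ->
  exists2 q, F q & \sum_(i <- r) c i *: p i = (\sum_(i <- r) c i) *: q.
Proof.
move=> cF [p0 Fp0] c0 Fp; elim: r => [|i r [q Fq IH]].
  by exists p0 => //; rewrite !big_nil scale0r.
rewrite !big_cons IH; set s := \sum_(j <- r) c j.
have s0 : 0 <= s by exact: sumr_ge0.
have [e|ne] := eqVneq (c i + s) 0.
  have [-> ->] : c i = 0 /\ s = 0 by have := c0 i; split; lra.
  by exists q; rewrite // addr0 !scale0r addr0.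
have gt0 : 0 < c i + s by rewrite lt_def ne addr_ge0.
exists ((c i / (c i + s)) *: p i + (1 - c i / (c i + s)) *: q).
  apply: cF => //; rewrite divr_ge0 ?addr_ge0//= ler_pdivrMr//; lra.
by rewrite scalerDr !scalerA; congr (_ *: _ + _ *: _); field.
Qed.

(** A conic combination of points of a convex set is its total weight times a single point. The
    empty combination puts 0 in every cone, which is where [F !=set0] enters. *)
Lemma coneE F x : segment_closed F -> F !=set0 ->
  cone F x <-> exists t p, [/\ 0 <= t, F p & x = t *: p].
Proof.
move=> cF F0; split=> [[n [p [c [Fp c0 ->]]]]|[t [p [t0 Fp ->]]]].
  have [q Fq ->] := segment_closed_sum (index_enum 'I_n) cF F0 c0 Fp.
  by exists (\sum_i c i), q; split=> //; exact: sumr_ge0.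
by exists 1%N, (fun=> p), (fun=> t); rewrite big_ord1.
Qed.

(** Finitely many strict inequalities survive a small enough perturbation: the tool behind every
    choice of a small [e]. *)
Lemma small_multiple (T : eqType) (s : seq T) (f g : T -> R) :
  {in s, forall i, 0 < f i} ->
  exists2 e : R, 0 < e & {in s, forall i, e * g i < f i}.
Proof.
elim: s => [|i s IH] f0; first by exists 1.
have [j js|e e0 eP] := IH; first by apply: f0; rewrite inE js orbT.
have fi0 : 0 < f i by apply: f0; rewrite mem_head.
have g1 : 0 < 1 + `|g i| by rewrite ltr_pwDl.
have m0 : 0 < Num.min e (f i / (1 + `|g i|)) by rewrite lt_min e0 divr_gt0.
exists (Num.min e (f i / (1 + `|g i|))) => // j; rewrite inE => /orP[/eqP->|js].
  apply: (@le_lt_trans _ _ (Num.min e (f i / (1 + `|g i|)) * `|g i|)).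
    by rewrite ler_wpM2l ?ler_norm// ltW.
  apply: (@le_lt_trans _ _ (f i / (1 + `|g i|) * `|g i|)).
    by rewrite ler_wpM2r// ge_min lexx orbT.
  by rewrite mulrAC ltr_pdivrMr// ltr_pM2l// ltrDr ltr01.
have [g0|g0] := leP (g j) 0.
  apply: le_lt_trans (f0 j _); last by rewrite inE js orbT.
  by rewrite mulr_ge0_le0// ltW.
apply: le_lt_trans (eP j js); rewrite ler_pM2r// ge_min lexx//.
Qed.

Lemma face_sub P F x : face P F -> F x -> P x.
Proof. by move=> [u ->] []. Qed.

Lemma faceP P F : face P F <->
  exists u, F = [set x | P x /\ forall y, P y -> ip y u <= ip x u].
Proof.
by split=> -[u ->]; exists u; apply/seteqP; split=> x /= [Px xM]; split=> // y /xM;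
  rewrite !ipmx.
Qed.

Lemma face_argmax P u M p : P p -> ip p u = M -> (forall x, P x -> ip x u <= M) ->
  face P [set x | P x /\ ip x u = M].
Proof.
move=> Pp pM leM; apply/faceP; exists u; apply/seteqP; split=> x /= [Px xM]; split=> //.
  by move=> y /leM; rewrite xM.
by apply/eqP; rewrite eq_le leM//= -pM; exact: xM.
Qed.

Lemma faceE P F p : face P F -> F p -> exists u,
  (forall x, P x -> ip x u <= ip p u) /\ (forall x, F x <-> P x /\ ip x u = ip p u).
Proof.
move=> /faceP[u ->] [Pp pM]; exists u; split=> // x; split=> [[Px xM]|[Px xp]].
  by split=> //; apply/eqP; rewrite eq_le pM//= xM.
by split=> // y Py; rewrite xp; exact: pM.
Qed.

Lemma face_segment_closed P F : segment_closed P -> face P F -> segment_closed F.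
Proof.
move=> cP /faceP[u ->] x y t [Px xM] [Py yM] /andP[t0 t1]; split.
  by apply: cP => //; rewrite t0.
move=> z Pz; rewrite !ipl; have h1 := xM z Pz; have h2 := yM z Pz.
have : 0 <= t * (ip x u - ip z u) by rewrite mulr_ge0// subr_ge0.
have : 0 <= (1 - t) * (ip y u - ip z u) by rewrite mulr_ge0// subr_ge0.
lra.
Qed.

Lemma symmN P x : centrally_symmetric P -> P x -> P (- x).
Proof. by move=> S Px; rewrite -S; exists x. Qed.

(** By symmetry the maximum [M] is nonnegative; if it were 0 the functional would vanish on [P] and
    the face would be all of [P]. *)
Lemma proper_faceP P F : centrally_symmetric P -> F !=set0 ->
  proper_face P F -> exists u M, [/\ 0 < M, forall x, P x -> ip x u <= M
    & forall x, F x <-> P x /\ ip x u = M].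
Proof.
move=> symP [p Fp] [fF neF]; have [u [leM FE]] := faceE fF Fp.
exists u, (ip p u); split=> //; rewrite lt_def; apply/andP; split; last first.
  have := leM _ (symmN symP (face_sub fF Fp)); rewrite ipl; lra.
apply: contra_notN neF => /eqP p0; apply/seteqP; split=> x; first by case/FE.
move=> Px; apply/FE; split=> //; apply/eqP; rewrite eq_le leM//=.
by have := leM _ (symmN symP Px); rewrite !ipl p0; lra.
Qed.

(** Minimality of [t] is tested on the functional of [F]: from [t *: p = s *: q] with [q] in [P] one
    gets [t * M <= s * M]. *)
Lemma dist_face P F b x t p : centrally_symmetric P -> proper_face P F ->
  F p -> 0 <= t -> x - b = t *: p -> dist P b x = t.
Proof.
move=> symP pF Fp t0 xE; have [u [M [M0 leM FE]]] := proper_faceP symP (ex_intro _ p Fp) pF.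
rewrite /dist; set E := [set _ | _].
have Et : E t by split=> //; exists p => //; case/FE: Fp.
have lbE : lbound E t.
  move=> s [s0 [q Pq]]; rewrite xE => /(congr1 (ip^~ u)); rewrite !ipl.
  have [_ ->] := (FE p).1 Fp => sq.
  by rewrite -(ler_pM2r M0) -sq ler_wpM2l// leM.
apply/eqP; rewrite eq_le lb_le_inf ?andbT//; last by exists t.
by apply: ge_inf => //; exists t.
Qed.

(** The dilation factor is the distance from 0, hence the same for both faces. *)
Lemma face_ray_inj P F F' t t' p p' : centrally_symmetric P ->
  proper_face P F -> proper_face P F' -> F p -> F' p' -> 0 < t -> 0 <= t' ->
  t *: p = t' *: p' -> t' = t /\ p = p'.
Proof.
move=> symP pF pF' Fp Fp' t0 t'0 e.
have tt : t' = t.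
  rewrite -(dist_face symP pF' Fp' t'0 (b := 0) (x := t *: p)) ?subr0//.
  by rewrite (dist_face symP pF Fp (ltW t0)) ?subr0.
by split=> //; apply: (scalerI (lt0r_neq0 t0)); rewrite e tt.
Qed.

Lemma bis_cellP V P F G a x : centrally_symmetric P -> segment_closed P ->
  proper_face P F -> proper_face P G -> F !=set0 -> G !=set0 ->
  bis_cell V P F G 0 a x <->
  V x /\ exists t p q, [/\ 0 <= t, F p, G q, x = t *: p & x - a = t *: q].
Proof.
move=> symP cP pF pG F0 G0.
have cF := face_segment_closed cP pF.1; have cG := face_segment_closed cP pG.1.
split=> [[[[Vx e] [y /(coneE _ cF F0)[t [p [t0 Fp ->]]]]]]|].
  rewrite addr0 => xE [z /(coneE _ cG G0)[s [q [s0 Gq ->]] zE]]; split=> //.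
  have xaE : x - a = s *: q by rewrite -zE addrK.
  have ts : t = s.
    by rewrite -(dist_face symP pG Gq s0 xaE) -e (dist_face symP pF Fp t0) ?subr0.
  by exists t, p, q; split=> //; rewrite xaE ts.
move=> [Vx [t [p [q [t0 Fp Gq xE xaE]]]]]; split; first split; first split=> //.
- rewrite (dist_face symP pG Gq t0 xaE).
  by rewrite (dist_face symP pF Fp t0) ?subr0.
- by exists x; rewrite ?addr0//; apply/coneE => //; exists t, p.
- by exists (x - a); rewrite ?subrK//; apply/coneE => //; exists t, q.
Qed.

Lemma bis_cell_sub V P F G F' G' a b : F `<=` F' -> G `<=` G' ->
  bis_cell V P F G a b `<=` bis_cell V P F' G' a b.
Proof.
have cone_sub A B : A `<=` B -> cone A `<=` cone B.
  by move=> AB x [n [p [c [Ap c0 ->]]]]; exists n, p, c; split=> // i; exact: AB.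
move=> FF GG x [[bx [y Fy yE]] [z Gz zE]].
by split; [split=> //; exists y|exists z] => //; [exact: cone_sub Fy|exact: cone_sub Gz].
Qed.

(** The private points [z i] make the [C i] pairwise incomparable; being cells that dominate all
    cells, they are then exactly the maximal ones. *)
Lemma N_exact V P a (I : finType) (C : I -> set 'rV[R]_d) (z : I -> 'rV[R]_d) :
  (forall i, cells V P 0 a (C i)) -> (forall i, C i (z i)) ->
  (forall i j, C i (z j) -> i = j) ->
  (forall D, cells V P 0 a D -> exists i, D `<=` C i) ->
  N V P a = #|I|.
Proof.
move=> cC Cz Czj domC.
have injC : injective C by move=> i j e; apply: Czj; rewrite e.
have maxE : maximal_cells V P 0 a = [set` [fset C i | i in I]%fset].
  apply/seteqP; split=> D /=.
    move=> [/domC[i Di] /(_ _ (cC i) Di) <-]; exact: in_imfset.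
  case/imfsetP => i _ ->; split=> [|E cE CE]; [exact: cC|]; have [j Ej] := domC _ cE.
  have ij : j = i by apply: Czj; apply/Ej/CE.
  by apply/seteqP; split=> //; rewrite -ij.
by rewrite /N /number_of maxE set_fsetK card_imfset //= cardE.
Qed.

(** Each [z i] lies in some maximal cell, and no cell of the family contains two of these points, so
    the maximal cells chosen are distinct. *)
Lemma N_lower V P a (I K : finType) (C : K -> set 'rV[R]_d) (z : I -> 'rV[R]_d)
    (Q : pred I) :
  (forall k, cells V P 0 a (C k)) ->
  (forall D, cells V P 0 a D -> exists k, D `<=` C k) ->
  (forall i, Q i -> exists k, C k (z i)) ->
  (forall k i j, Q i -> Q j -> C k (z i) -> C k (z j) -> i = j) ->
  (#|Q| <= N V P a)%N.
Proof.
move=> cC domC Cz injz.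
(* [number_of] is meaningful only on finite sets, so finiteness comes before any counting. *)
have finM : finite_set (maximal_cells V P 0 a).
  apply: (@sub_finite_set _ _ [set` [fset C k | k in K]%fset]) => //.
  move=> D [/domC[k Dk] /(_ _ (cC k) Dk) <-] /=; exact: in_imfset.
(* Among the members containing [z i], one with the most members below it is maximal for
   inclusion. *)
pose below k := #|[pred l | `[< C l `<=` C k >]]|.
have maxz i : Q i -> exists k, maximal_cells V P 0 a (C k) /\ C k (z i).
  move=> Qi; have [k0 Ck0] := Cz i Qi.
  have [k /asboolP Ckz kmax] := @arg_maxnP _ k0 (fun k => `[< C k (z i) >]) below
    (introT (asboolP _) Ck0).
  exists k; split=> //; split=> [|D cD CD]; [exact: cC|]; have [l Dl] := domC D cD.
  have Ckl : C k `<=` C l by move=> y /CD /Dl.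
  apply/seteqP; split=> //; apply: subset_trans Dl _; apply: contrapT => nlk.
  have := kmax l (introT (asboolP _) (Ckl _ Ckz)); rewrite /geq /= leqNgt => /negP; apply.
  apply: proper_card; apply/properP; split.
    by apply/fintype.subsetP => m; rewrite !inE => mk y /mk /Ckl.
  by exists l; [rewrite inE|apply/negP; rewrite inE].
have [i0 Qi0|Q0] := pickP Q; last by rewrite eq_card0.
(* Indices outside [Q] get an arbitrary value; [i0] guarantees that there is one. *)
have /choice[k kP] : forall i, exists k, Q i -> maximal_cells V P 0 a (C k) /\ C k (z i).
  move=> i; case: (boolP (Q i)) => [/maxz[k ?]|]; first by exists k.
  by have [k _] := maxz _ Qi0; exists k.
have <- : #|` [fset C (k i) | i in Q]%fset| = #|Q|.
  rewrite card_in_imfset //= ?cardE // => i j Qi Qj e.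
  by apply: (injz (k i)) => //; [exact: (kP i Qi).2|rewrite e; exact: (kP j Qj).2].
rewrite /N /number_of; apply: fsubset_leq_card; apply/fsubsetP => D.
case/imfsetP => i /= Qi ->; rewrite in_fset_set// inE; exact: (kP i Qi).1.
Qed.

End Functionals.

(** * Polytopes given by inequalities *)

Section Halfspaces.
Set Implicit Arguments.
Unset Strict Implicit.
Unset Printing Implicit Defensive.
Context {R : realType} {d : nat} {I : finType}.
(** The common setting for the cube, the cross-polytope and the root polytope. At [x i] inequality
    [i] alone is tight, so [x i] singles out its facet; [opp] carries the central symmetry. *)
Variables (V P : set 'rV[R]_d) (u : I -> 'cV[R]_d) (x : I -> 'rV[R]_d)
  (opp : I -> I).
Hypotheses (V0 : V 0) (VD : forall y z t, V y -> V z -> V (t *: y + z))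
  (PE : forall y, P y <-> V y /\ forall i, ip y (u i) <= 1)
  (Px : forall i, P (x i)) (ux : forall i, ip (x i) (u i) = 1)
  (ux_lt : forall i j, j != i -> ip (x i) (u j) < 1)
  (oppK : involutive opp)
  (u_opp : forall y i, V y -> ip y (u (opp i)) = - ip y (u i)).

Definition hface i : set 'rV[R]_d := [set y | P y /\ ip y (u i) = 1].

Lemma hpoly_segment_closed : segment_closed P.
Proof using VD PE V0.
move=> y z t /PE[Vy uy] /PE[Vz uz] /andP[t0 t1]; apply/PE; split.
  by apply: VD => //; rewrite -[_ *: z]addr0; exact: VD.
move=> i; rewrite !ipl.
have : 0 <= t * (1 - ip y (u i)) by rewrite mulr_ge0// subr_ge0.
have : 0 <= (1 - t) * (1 - ip z (u i)) by rewrite mulr_ge0// subr_ge0.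
lra.
Qed.

Lemma hpoly_sym : centrally_symmetric P.
Proof using VD PE V0 oppK u_opp.
have PN y : P y -> P (- y).
  move=> /PE[Vy uy]; apply/PE; split.
    by rewrite -[- y]addr0 -scaleN1r; exact: VD.
  by move=> i; rewrite ipl -u_opp.
apply/seteqP; split=> [_ [y Py <-]|y Py]; first exact: PN.
by exists (- y); [exact: PN|rewrite opprK].
Qed.

Lemma hface_proper i : proper_face P (hface i).
Proof using V0 PE Px ux.
split; first by apply: face_argmax (Px i) (ux i) _ => y /PE[].
have P0 : P 0 by apply/PE; split=> // j; rewrite ipl.
by move=> e; move: P0; rewrite -e => -[_]; rewrite ipl => /esym/eqP; rewrite oner_eq0.
Qed.

Lemma hface_inj i j : hface i (x j) -> i = j.
Proof using ux_lt.
move=> [_ e]; apply: contrapT => /eqP ne; have := ux_lt ne; rewrite e; lra.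
Qed.

(* If a face avoids every [hface i], the average of points witnessing this
   satisfies all the inequalities strictly, so the functional defining the
   face vanishes on [V]. *)
Lemma proper_face_sub F : I -> F !=set0 -> proper_face P F -> exists i, F `<=` hface i.
Proof using VD PE V0.
move=> i0 [p Fp] [fF neF]; have [w [leM FE]] := faceE fF Fp.
apply: contrapT => /forallNP nsub.
have /choice[y yP] : forall i, exists y, F y /\ ip y (u i) < 1.
  move=> i; apply: contrapT => /forallNP h; apply: (nsub i) => y Fy.
  have Py := face_sub fF Fy; split=> //; apply/eqP; rewrite eq_le.
  have /PE[_ ->] /= := Py; rewrite leNgt; apply/negP => lt1; exact: (h y).
have [q Fq] := segment_closed_sum (index_enum I) (face_segment_closed hpoly_segment_closed fF)
  (ex_intro _ p Fp) (fun=> @ler01 R) (fun i => (yP i).1).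
under eq_bigr do rewrite scale1r.
set c := \sum_(i : I) 1 => qE.
have c0 : 0 < c by rewrite /c (bigD1 i0)//= ltr_wpDr// sumr_ge0.
have q1 i : ip q (u i) < 1.
  rewrite -(ltr_pM2l c0) mulr1 -ipZl -qE ip_suml /c [X in X < _](bigD1 i)//=.
  rewrite [X in _ < X](bigD1 i)//=.
  apply: ltr_leD; first exact: (yP i).2.
  by apply: ler_sum => j _; have /PE[_] := face_sub fF (yP j).1; apply.
have /PE[Vq _] := face_sub fF Fq.
have w0 v : V v -> ip v w <= 0.
  move=> Vv; have [e e0 eP] := @small_multiple _ _ (index_enum I)
    (fun i => 1 - ip q (u i)) (fun i => ip v (u i)) (fun i _ => etrans (subr_gt0 _ _) (q1 i)).
  have /leM : P (e *: v + q).
    apply/PE; split=> [|i]; first exact: VD.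
    by have := eP i (mem_index_enum i); rewrite !ipl; lra.
  by have [_ <-] := (FE q).1 Fq; rewrite !ipl gerDr pmulr_rle0.
have w00 v : V v -> ip v w = 0.
  move=> Vv; apply/eqP; rewrite eq_le w0//= -oppr_le0 -ipNl; apply: w0.
  by rewrite -[- v]addr0 -scaleN1r; exact: VD.
apply: neF; apply/seteqP; split=> [z /(face_sub fF)//|z Pz]; apply/FE; split=> //.
have /PE[Vz _] := Pz; have /PE[Vp _] := face_sub fF Fp.
by rewrite !w00.
Qed.

Lemma hcell_dom a D : I -> (forall F, proper_face P F -> F !=set0) ->
  cells V P 0 a D -> exists ij : I * I, D `<=` bis_cell V P (hface ij.1) (hface ij.2) 0 a.
Proof using VD PE V0.
move=> i0 F0 [F [G [pF pG ->]]].
have [i Fi] := proper_face_sub i0 (F0 _ pF) pF.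
have [j Gj] := proper_face_sub i0 (F0 _ pG) pG.
by exists (i, j); exact: bis_cell_sub.
Qed.

Lemma hcellP a i j y : bis_cell V P (hface i) (hface j) 0 a y <->
  V y /\ exists t p q, [/\ 0 <= t, hface i p, hface j q, y = t *: p & y - a = t *: q].
Proof using VD PE V0 Px ux oppK u_opp.
have H k : proper_face P (hface k) /\ hface k !=set0.
  by split; [exact: hface_proper|exists (x k)].
apply: bis_cellP; [exact: hpoly_sym|exact: hpoly_segment_closed|..];
  exact: (H _).1 || exact: (H _).2.
Qed.

(* [lam] is the largest zero of the functions
   [t => t * (ip (x i) (u j) - 1) - ip a (u j)], [j != i]: at [lam *: x i] the
   ray through [x i] meets the bisector. *)
Lemma bisector_on_ray a i : V a -> 0 <= ip a (u i) ->
  exists lam j, 0 < lam /\ bis_cell V P (hface i) (hface j) 0 a (lam *: x i).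
Proof using VD PE V0 Px ux ux_lt oppK u_opp.
move=> Va ai.
pose f j : R := - ip a (u j) / (1 - ip (x i) (u j)).
have Vx : V (x i) by have /PE[] := Px i.
have oi : opp i != i.
  by apply/eqP => e; have := u_opp i Vx; rewrite e ux; lra.
have [j ji jmax] := @arg_maxP _ R I (opp i) (fun j => j != i) f oi.
have {}jmax l : l != i -> f l <= f j by exact: jmax.
have dpos l : l != i -> 0 < 1 - ip (x i) (u l) by move=> /ux_lt; rewrite subr_gt0.
(* The opposite index always competes, with value [ip a (u i) / 2]; this bounds the largest zero
   from below. *)
have fj : ip a (u i) / 2 <= f j.
  have <- : f (opp i) = ip a (u i) / 2 by rewrite /f !u_opp// ux !opprK.
  exact: jmax.
(* After division by [lam], the conditions say that [x i - lam^-1 *: a] lies in [P] with inequality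
   [k] tight. *)
suff [lam [k [lam0 lamk lamP]]] : exists lam k, [/\ 0 < lam,
    lam * ip (x i) (u k) - ip a (u k) = lam & forall l, lam * ip (x i) (u l) - ip a (u l) <= lam].
  exists lam, k; split=> //; apply/hcellP; split.
    by rewrite -[_ *: _]addr0; exact: VD.
  exists lam, (x i), (x i - lam^-1 *: a).
  have uq l : ip (x i - lam^-1 *: a) (u l) = (lam * ip (x i) (u l) - ip a (u l)) / lam.
    by rewrite !ipl; field; rewrite gt_eqF.
  split=> //; first exact: ltW.
    split; last by rewrite uq lamk divff// gt_eqF.
    apply/PE; split; last by move=> l; rewrite uq ler_pdivrMr// mul1r.
    by rewrite addrC -scaleNr; exact: VD.
  by rewrite scalerBr scalerA divff ?gt_eqF// scale1r.
have [a0|a0] := eqVneq (ip a (u i)) 0.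
  (* Here the largest zero may fail to be positive. Since [ip a (u i) = 0], inequality [i] stays
     tight for every [lam], so any positive [lam] beyond all zeros gives a point of the cell of
     [(i, i)]. *)
  exists (Num.max 1 (f j)), i; split; first by rewrite lt_max ltr01.
    by rewrite ux a0; lra.
  move=> l; have [->|li] := eqVneq l i; first by rewrite ux a0; lra.
  have : f l <= Num.max 1 (f j) by rewrite le_max jmax ?orbT//.
  by rewrite /f ler_pdivrMr ?dpos//; lra.
exists (f j), j; split.
- by apply: lt_le_trans fj; rewrite divr_gt0 ?ltr0n// lt_def a0.
- by have := dpos j ji; rewrite /f => dj; field; rewrite gt_eqF.
move=> l; have [->|li] := eqVneq l i; first by rewrite ux; lra.
by have := jmax l li; rewrite {1}/f ler_pdivrMr ?dpos//; lra.
Qed.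

(** The ray through [lam i *: x i] leaves [P] at [x i], which lies on no other [hface]; so this
    point determines the first facet of any cell containing it. [opp] maps the complement of [Q]
    into [Q]. *)
Lemma N_ge_half a : V a -> (forall F, proper_face P F -> F !=set0) ->
  (#|I| <= 2 * N V P a)%N.
Proof using VD PE V0 Px ux ux_lt oppK u_opp.
move=> Va F0; have [i0 _|I0] := pickP (xpredT : pred I); last first.
  by rewrite eq_card0// => i; have := I0 i.
pose Q i := 0 <= ip a (u i).
have /choice[lam lamP] : forall i, exists lam : R, Q i -> exists j, 0 < lam /\
    bis_cell V P (hface i) (hface j) 0 a (lam *: x i).
  move=> i; case: (boolP (Q i)) => [Qi|]; last by exists 0.
  by have [l [j ?]] := bisector_on_ray Va Qi; exists l => _; exists j.
have QN : (#|Q| <= N V P a)%N.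
  apply: (@N_lower _ _ V P a I (I * I)%type
    (fun ij => bis_cell V P (hface ij.1) (hface ij.2) 0 a) (fun i => lam i *: x i)).
  - by move=> [i j]; exists (hface i), (hface j); split=> //; exact: hface_proper.
  - by move=> D; exact: hcell_dom.
  - by move=> i Qi; have [j [_ ?]] := lamP i Qi; exists (i, j).
  have uniq_facet k i : Q i -> bis_cell V P (hface k.1) (hface k.2) 0 a (lam i *: x i) -> k.1 = i.
    move=> Qi /hcellP[_ [t [p [q [t0 Fp _ e _]]]]]; apply: hface_inj.
    have [j [lam0 _]] := lamP i Qi; suff -> : x i = p by [].
    have Fxi : hface i (x i) by [].
    by case: (face_ray_inj hpoly_sym (hface_proper i) (hface_proper k.1) Fxi Fp lam0 t0 e).
  by move=> k i j Qi Qj /(uniq_facet _ _ Qi)<- /(uniq_facet _ _ Qj).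
have Qopp : (#|[predC Q]| <= #|Q|)%N.
  rewrite -(card_imset _ (inv_inj oppK)); apply/subset_leq_card/fintype.subsetP => i.
  case/imsetP => j; rewrite inE /Q -ltNge => aj ->; rewrite unfold_in u_opp//.
  by rewrite oppr_ge0 ltW.
by rewrite -(cardC Q) mulSn mul1n leq_add// (leq_trans Qopp).
Qed.

End Halfspaces.

(** * Cross-polytopes and root polytopes *)

Section ConvexHulls.
Set Implicit Arguments.
Unset Strict Implicit.
Unset Printing Implicit Defensive.
Context {R : realType} {d : nat}.
Implicit Types (A P F : set 'rV[R]_d) (x y : 'rV[R]_d) (u : 'cV[R]_d).

(** Allows weights indexed by any finite type, such as pairs, where [conv] asks for an initial
    segment of the integers. *)
Lemma conv_fin (J : finType) (Q : pred J) (c : J -> R) (p : J -> 'rV[R]_d) A :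
  (forall j, Q j -> A (p j)) -> (forall j, Q j -> 0 <= c j) ->
  \sum_(j | Q j) c j = 1 -> conv A (\sum_(j | Q j) c j *: p j).
Proof.
move=> Ap c0 c1; exists #|Q|, (fun k => p (enum_val k)), (fun k => c (enum_val k)).
split=> [i|i||].
- exact: Ap (enum_valP i).
- exact: c0 (enum_valP i).
- by rewrite -(big_enum_val c).
- exact: (big_enum_val (fun j => c j *: p j)).
Qed.

Lemma sub_conv A : A `<=` conv A.
Proof.
by move=> x Ax; exists 1%N, (fun=> x), (fun=> 1); split=> //; rewrite big_ord1 ?scale1r.
Qed.

Lemma conv_le A u M x : (forall p, A p -> ip p u <= M) -> conv A x -> ip x u <= M.
Proof.
move=> AM [n [p [c [Ap c0 c1 ->]]]]; rewrite ip_suml -[M]mul1r -c1 mulr_suml.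
by apply: ler_sum => i _; rewrite ipl ler_wpM2l// AM.
Qed.

Lemma conv_segment_closed A : segment_closed (conv A).
Proof.
move=> _ _ t [n [p [c [Ap c0 c1 ->]]]] [m [q [e [Aq e0 e1 ->]]]] /andP[t0 t1].
pose J := ('I_n + 'I_m)%type.
pose w (j : J) := match j with inl i => t * c i | inr i => (1 - t) * e i end.
pose r (j : J) := match j with inl i => p i | inr i => q i end.
rewrite [X in conv A X](_ : _ = \sum_(j : J) w j *: r j); last first.
  by rewrite big_sumType /= !scaler_sumr; congr (_ + _); apply: eq_bigr => i _;
    rewrite scalerA.
apply: conv_fin => [[] i _//=|[] i _ /=|]; rewrite ?mulr_ge0 ?subr_ge0//.
by rewrite big_sumType /= -!mulr_sumr c1 e1; ring.
Qed.

Lemma finite_argmax (T : eqType) (A : set T) (f : T -> R) : finite_set A -> A !=set0 ->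
  exists2 x, A x & forall y : T, A y -> f y <= f x.
Proof.
move=> /finite_seqP[s ->] [x0 /= x0s].
elim: s x0 x0s => // x s IH x0 _.
case: s IH => [_|y s IH].
  by exists x; rewrite /= ?mem_head// => y; rewrite inE => /eqP->.
have [z zs zM] := IH y (mem_head _ _).
have [xz|zx] := leP (f x) (f z).
  by exists z => [|v]; rewrite /= inE ?zs ?orbT// => /orP[/eqP->//|]; exact: zM.
exists x => [|v]; rewrite /= inE ?eqxx// => /orP[/eqP->//|/zM vz].
exact: le_trans vz (ltW zx).
Qed.

(** The definition of [face] admits an empty set of maximizers; on the hull of a finite set the
    maximum is attained at a generator. *)
Lemma face_conv_neq0 A F : finite_set A -> A !=set0 -> face (conv A) F -> F !=set0.
Proof.
move=> finA A0 /faceP[u ->]; have [x Ax xM] := finite_argmax (ip^~ u) finA A0.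
by exists x; split; [exact: sub_conv|move=> y; exact: conv_le].
Qed.

Lemma ip_stdb i u : ip (stdb R i) u = u i 0.
Proof. by rewrite -ipmx /stdb -rowE mxE. Qed.

End ConvexHulls.

(** * Cross-polytopes: facets indexed by sign vectors *)

Section CrossPolytope.
Set Implicit Arguments.
Unset Strict Implicit.
Unset Printing Implicit Defensive.
Context {R : realType} {d : nat}.
Hypothesis d_gt0 : (0 < d)%N.

Notation I := {ffun 'I_d -> bool}.
Let sgn (S : I) i : R := if S i then 1 else -1.
Definition cross_normal (S : I) : 'cV[R]_d := \col_i sgn S i.
(** The barycentre of the [d] vertices of the facet with sign vector [S]. *)
Definition cross_center (S : I) : 'rV[R]_d := d%:R^-1 *: \row_i sgn S i.

Let dR : 0 < d%:R :> R. Proof. by rewrite ltr0n. Qed.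

Lemma ip_cross_normal y S : ip y (cross_normal S) = \sum_i y 0 i * sgn S i.
Proof. by rewrite ipE; apply: eq_bigr => i _; rewrite mxE. Qed.

Lemma ip_cross_center S T :
  ip (cross_center S) (cross_normal T) = d%:R^-1 * \sum_i sgn S i * sgn T i.
Proof.
by rewrite ipl ip_cross_normal; congr (_ * _); apply: eq_bigr => i _; rewrite mxE.
Qed.

Lemma cross_center_eq1 S : ip (cross_center S) (cross_normal S) = 1.
Proof.
rewrite ip_cross_center (eq_bigr (fun=> 1)) ?sumr_const ?card_ord ?mulVf ?gt_eqF//.
by move=> i _; rewrite /sgn; case: (S i); ring.
Qed.

Lemma cross_center_lt1 S T : T != S -> ip (cross_center S) (cross_normal T) < 1.
Proof.
move=> neTS; have [i neTi] : exists i, T i != S i.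
  apply: contrapT => /forallNP h; move/eqP: neTS; apply; apply/ffunP => i.
  by apply/eqP/negPn/negP; exact: h.
rewrite -(cross_center_eq1 S) !ip_cross_center ltr_pM2l ?invr_gt0//.
rewrite [X in X < _](bigD1 i)//= [X in _ < X](bigD1 i)//=.
apply: ltr_leD.
  by move: neTi; rewrite /sgn; case: (S i); case: (T i) => // _; lra.
by apply: ler_sum => j _; rewrite /sgn; case: (S j); case: (T j); lra.
Qed.

Lemma cross_polytopeE y : cross_polytope R d y <->
  [set: 'rV[R]_d] y /\ forall S, ip y (cross_normal S) <= 1.
Proof.
split=> [Py|[_ yS]].
  split=> // S; apply: conv_le Py => _ [i [->|->]]; rewrite ?ipl ip_stdb mxE /sgn;
    by case: (S i); lra.
set m := \sum_i `|y 0 i|.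
have m1 : m <= 1.
  apply: le_trans (yS [ffun i => 0 <= y 0 i]); rewrite ip_cross_normal.
  apply: ler_sum => i _; rewrite /sgn ffunE.
  by have [h|h] := leP 0 (y 0 i); rewrite /= ?mulr1 ?mulrN1 ?(ger0_norm h) ?(ltr0_norm h).
(* The weight of a signed basis vector is the positive part of the signed coordinate, plus an equal
   share of the slack [1 - m]; these shares cancel between opposite vectors. *)
pose c (j : 'I_d * bool) := (`|y 0 j.1| + if j.2 then y 0 j.1 else - y 0 j.1) / 2
  + (1 - m) / (2 * d%:R).
pose p (j : 'I_d * bool) := if j.2 then stdb R j.1 else - stdb R j.1.
have -> : y = \sum_j c j *: p j.
  rewrite -(pair_bigA _ (fun i b => c (i, b) *: p (i, b))) /= {1}[y]row_sum_delta.
  apply: eq_bigr => i _; rewrite big_bool /c /p /= scalerN -scalerBl; congr (_ *: _).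
  by field; rewrite gt_eqF.
apply: conv_fin => [[i []] _|[i b] _|].
- by exists i; left.
- by exists i; right.
- rewrite /c /= addr_ge0 ?divr_ge0 ?mulr_ge0 ?subr_ge0//.
  by case: b; have := ler_norm (y 0 i); have := ler_norm (- y 0 i); rewrite normrN; lra.
rewrite -(pair_bigA _ (fun i b => c (i, b))) /=.
rewrite (eq_bigr (fun i => `|y 0 i| + (1 - m) / d%:R)).
  rewrite big_split /= sumr_const card_ord -/m -[_ *+ d]mulr_natr; field; by rewrite gt_eqF.
by move=> i _; rewrite big_bool /c /=; field; rewrite gt_eqF.
Qed.

Lemma cross_N_ge (a : 'rV[R]_d) : (2 ^ d <= 2 * N setT (cross_polytope R d) a)%N.
Proof.
rewrite -[X in (X ^ _)%N]card_bool -[X in (_ ^ X)%N](card_ord d) -card_ffun.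
have [finA A0] : finite_set [set x | exists i, x = stdb R i \/ x = - stdb R i :> 'rV[R]_d]
    /\ [set x | exists i, x = stdb R i \/ x = - stdb R i :> 'rV[R]_d] !=set0.
  split; last by exists (stdb R (Ordinal d_gt0)), (Ordinal d_gt0); left.
  apply: sub_finite_set (finite_image (fun j : 'I_d * bool =>
    if j.2 then stdb R j.1 else - stdb R j.1) (@finite_finset _ setT)).
  by move=> _ [i [->|->]]; [exists (i, true)|exists (i, false)].
have Pc S : cross_polytope R d (cross_center S).
  apply/cross_polytopeE; split=> // T.
  by have [->|/cross_center_lt1/ltW//] := eqVneq T S; rewrite cross_center_eq1.
apply: (@N_ge_half _ _ _ setT (cross_polytope R d) cross_normal cross_center
  (fun S => [ffun i => ~~ S i])) => //.
- exact: cross_polytopeE.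
- exact: cross_center_eq1.
- exact: cross_center_lt1.
- by move=> S; apply/ffunP => i; rewrite !ffunE negbK.
- move=> y S _; rewrite !ip_cross_normal -sumrN; apply: eq_bigr => i _.
  by rewrite /sgn ffunE; case: (S i) => /=; ring.
- by move=> F [fF _]; exact: face_conv_neq0 fF.
Qed.

End CrossPolytope.

(** * Root polytopes: facets indexed by proper nonempty subsets *)

Section RootPolytope.
Set Implicit Arguments.
Unset Strict Implicit.
Unset Printing Implicit Defensive.
Context {R : realType} {d : nat}.
Hypothesis d_gt1 : (1 < d)%N.

Notation I := {S : {ffun 'I_d -> bool} | S \notin pred2 [ffun=> true] [ffun=> false]}.
Let ind (S : I) i : R := (val S i)%:R.
Let size1 (S : I) : R := \sum_i ind S i.
Let size0 (S : I) : R := \sum_i (1 - ind S i).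
(** On the hyperplane, the indicators of [S] and of its complement are opposite functionals, and the
    two constant vectors vanish; hence their exclusion from [I]. *)
Definition root_normal (S : I) : 'cV[R]_d := \col_i ind S i.
(** The barycentre of the roots [e_i - e_j] with [i] in [S] and [j] outside. *)
Definition root_center (S : I) : 'rV[R]_d :=
  \row_i (ind S i / size1 S - (1 - ind S i) / size0 S).

Lemma ind01 S i : (ind S i = 1 \/ ind S i = 0).
Proof. by rewrite /ind; case: (val S i); [left|right]. Qed.

Lemma root_size_gt0 S : 0 < size1 S /\ 0 < size0 S.
Proof.
have := valP S; rewrite !inE negb_or => /andP[neT neF].
have ex b : val S != [ffun=> ~~ b] -> exists i, val S i = b.
  move=> neS; apply: contrapT => /forallNP h; move/eqP: neS; apply; apply/ffunP => i.
  by rewrite ffunE; move: (h i) => {h}; case: b; case: (val S i).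
split; [have [i Si] := ex true neF|have [i Si] := ex false neT];
  rewrite /size1 /size0 (bigD1 i)//= {1}/ind Si ltr_pwDl ?subr0// sumr_ge0// => j _;
  case: (ind01 S j) => ->; lra.
Qed.

Lemma ip_root_normal y S : ip y (root_normal S) = \sum_i y 0 i * ind S i.
Proof. by rewrite ipE; apply: eq_bigr => i _; rewrite mxE. Qed.

Lemma root_center_sum0 S : sum0_hyperplane R d (root_center S).
Proof.
have [s1 s0] := root_size_gt0 S; rewrite /sum0_hyperplane /=.
under eq_bigr do rewrite mxE; rewrite sumrB -!mulr_suml -/(size1 S) -/(size0 S).
by rewrite !divff ?gt_eqF// subrr.
Qed.

Lemma root_center_eq1 S : ip (root_center S) (root_normal S) = 1.
Proof.
have [s1 s0] := root_size_gt0 S; rewrite ip_root_normal.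
rewrite (eq_bigr (fun i => ind S i / size1 S)).
  by rewrite -mulr_suml divff ?gt_eqF.
by move=> i _; rewrite mxE; case: (ind01 S i) => ->; ring.
Qed.

Lemma root_center_lt1 S T : T != S -> ip (root_center S) (root_normal T) < 1.
Proof.
move=> neTS; have [i neTi] : exists i, val T i != val S i.
  apply: contrapT => /forallNP h; move/eqP: neTS; apply; apply/val_inj/ffunP => i.
  by apply/eqP/negPn/negP; exact: h.
have [s1 s0] := root_size_gt0 S.
have [v1 v0] : 0 < (size1 S)^-1 /\ 0 < (size0 S)^-1 by rewrite !invr_gt0.
rewrite -(root_center_eq1 S) !ip_root_normal.
rewrite [X in X < _](bigD1 i)//= [X in _ < X](bigD1 i)//=.
apply: ltr_leD; last apply: ler_sum => j _; rewrite !mxE.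
  by move: neTi; rewrite /ind; case: (val S i); case: (val T i) => //= _; lra.
by rewrite /ind; case: (val S j); case: (val T j) => //=; lra.
Qed.

(** A transport argument: the positive and negative parts of [y] have the same mass [m], at most 1
    by the inequality of the set where [y] is nonnegative, and their product coupling writes [y] as
    a combination of roots. *)
Lemma root_polytopeE y : root_polytope R d y <->
  sum0_hyperplane R d y /\ forall S, ip y (root_normal S) <= 1.
Proof.
split=> [Py|[y0 yS]].
  have ip1 (z : 'rV[R]_d) : ip z (const_mx 1) = \sum_i z 0 i.
    by rewrite ipE; apply: eq_bigr => i _; rewrite mxE mulr1.
  split=> [|S]; last first.
    apply: conv_le Py => _ [i [j [_ ->]]]; rewrite !ipl !ip_stdb !mxE.
    by case: (ind01 S i) => ->; case: (ind01 S j) => ->; lra.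
  rewrite /sum0_hyperplane /= -ip1; apply/eqP; rewrite eq_le.
  rewrite -[X in _ && X]oppr_le0 -ipNr.
  by apply/andP; split; apply: conv_le Py => _ [i [j [_ ->]]];
    rewrite ?ipr !ipl !ip_stdb !mxE; lra.
pose pos i := Num.max (y 0 i) 0; pose neg i := pos i - y 0 i.
have pos0 i : 0 <= pos i by rewrite le_max lexx orbT.
have neg0 i : 0 <= neg i by rewrite subr_ge0 le_max lexx.
have posneg i : pos i * neg i = 0.
  by rewrite /neg /pos; case: leP => _; ring.
pose m := \sum_i pos i.
have mneg : \sum_i neg i = m by rewrite sumrB y0 subr0.
have m0 : 0 <= m by exact: sumr_ge0.
have m1 : m <= 1.
  pose S0 : {ffun 'I_d -> bool} := [ffun i => 0 <= y 0 i].
  have mE : m = \sum_i y 0 i * (S0 i)%:R.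
    by apply: eq_bigr => i _; rewrite /pos ffunE; case: leP; rewrite ?mulr1 ?mulr0.
  have [nS|] := boolP (S0 \notin pred2 [ffun=> true] [ffun=> false]).
    by rewrite mE; have := yS (exist _ S0 nS); rewrite ip_root_normal.
  (* A constant [S0] is not an index of an inequality, but then [m] is the full or the empty
     coordinate sum, that is 0. *)
  rewrite negbK !inE mE => /orP[/eqP->|/eqP->].
    by under eq_bigr do rewrite ffunE mulr1; rewrite y0.
  by under eq_bigr do rewrite ffunE mulr0; rewrite big1.
pose Q (j : 'I_d * 'I_d) := j.1 != j.2.
pose D : R := \sum_(j | Q j) 1.
have D0 : 0 < D.
  rewrite /D (bigD1 (Ordinal (ltnW d_gt1), Ordinal d_gt1))//=.
  by rewrite ltr_pwDl// sumr_ge0.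
(* Product coupling plus an even share of the slack, which cancels between [(i, j)] and [(j, i)]. *)
pose c (j : 'I_d * 'I_d) := pos j.1 * neg j.2 / m + (1 - m) / D.
pose p (j : 'I_d * 'I_d) := stdb R j.1 - stdb R j.2.
(* For [m = 0] the quotient is 0 by convention, and the bounds force [x = 0]. *)
have mm x : 0 <= x <= m -> x * m / m = x.
  by have [->|ne] := eqVneq m 0; [move=> h; lra|rewrite mulfK].
have pos_le i : 0 <= pos i <= m.
  by rewrite pos0 /m (bigD1 i)//= lerDl sumr_ge0.
have neg_le i : 0 <= neg i <= m.
  by rewrite neg0 -mneg (bigD1 i)//= lerDl sumr_ge0.
have -> : y = \sum_(j | Q j) c j *: p j.
  rewrite big_mkcond (eq_bigr (fun j => c j *: p j)); last first.
    move=> [i j] _; rewrite /Q /p /=; case: eqP => //= ->.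
    by rewrite subrr scaler0.
  rewrite -(pair_bigA _ (fun i j => c (i, j) *: p (i, j))) /=.
  rewrite (eq_bigr (fun i => \sum_j c (i, j) *: stdb R i - \sum_j c (i, j) *: stdb R j)).
    rewrite sumrB [X in _ - X]exchange_big -sumrB {1}[y]row_sum_delta.
    apply: eq_bigr => i _; rewrite -!scaler_suml -scalerBl; congr (_ *: _).
    pose e := \sum_(j < d) (1 - m) / D.
    have -> : \sum_j c (i, j) = pos i + e.
      by rewrite big_split /= -mulr_suml -mulr_sumr mneg mm.
    have -> : \sum_j c (j, i) = neg i + e.
      by rewrite big_split /= -mulr_suml -mulr_suml -/m [m * _]mulrC mm.
    by rewrite /neg; ring.
  by move=> i _; rewrite -sumrB; apply: eq_bigr => j _; rewrite scalerBr.
apply: conv_fin => [[i j] /= /eqP ij|[i j] _|].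
- by exists i, j.
- apply: addr_ge0; apply: divr_ge0 => //=; [exact: mulr_ge0| |exact: ltW].
  by rewrite subr_ge0.
rewrite /c big_split /= -!mulr_suml.
rewrite (_ : \sum_(j | Q j) _ = m * m); last first.
  rewrite big_mkcond (eq_bigr (fun j => pos j.1 * neg j.2)).
    rewrite -(pair_bigA _ (fun i j => pos i * neg j)) /=.
    by rewrite -{2}mneg mulr_suml; apply: eq_bigr => i _; rewrite mulr_sumr.
  by move=> [i j] _; rewrite /Q /=; case: eqP => //= ->; rewrite posneg.
rewrite mm ?lexx ?m0// (_ : \sum_(j | Q j) _ = (1 - m) * D).
  by rewrite mulfK ?gt_eqF//; ring.
by rewrite /D mulr_sumr; apply: eq_bigr => j _; rewrite mulr1.
Qed.

Lemma root_N_ge (a : 'rV[R]_d) : sum0_hyperplane R d a ->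
  (2 ^ d - 2 <= 2 * N (sum0_hyperplane R d) (root_polytope R d) a)%N.
Proof.
move=> a0.
have <- : #|{: I}| = (2 ^ d - 2)%N.
  rewrite card_sig -[X in (X ^ _)%N]card_bool -[X in (_ ^ X)%N](card_ord d) -card_ffun.
  rewrite -(cardC (pred2 [ffun=> true] [ffun=> false])) card2.
  have -> : [ffun=> true] != [ffun=> false] :> {ffun 'I_d -> bool}.
    by apply/eqP => /ffunP/(_ (Ordinal d_gt1)); rewrite !ffunE.
  by rewrite addKn; apply: eq_card => S; rewrite !inE.
pose A := [set x : 'rV[R]_d | exists i j, i <> j /\ x = stdb R i - stdb R j].
have [finA A0] : finite_set A /\ A !=set0.
  split; last first.
    by exists (stdb R (Ordinal (ltnW d_gt1)) - stdb R (Ordinal d_gt1)),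
      (Ordinal (ltnW d_gt1)), (Ordinal d_gt1).
  apply: sub_finite_set (finite_image (fun j : 'I_d * 'I_d =>
    stdb R j.1 - stdb R j.2) (@finite_finset _ setT)).
  by move=> _ [i [j [_ ->]]]; exists (i, j).
have oppP (S : I) : [ffun i => ~~ val S i] \notin pred2 [ffun=> true] [ffun=> false].
  have := valP S; apply: contra; rewrite !inE orbC => /orP[] /eqP/ffunP e;
    apply/orP; [left|right]; apply/eqP/ffunP => i;
    by have := e i; rewrite !ffunE; case: (val S i).
pose opp (S : I) : I := exist (fun T : {ffun 'I_d -> bool} =>
  is_true (T \notin pred2 [ffun=> true] [ffun=> false])) _ (oppP S).
apply: (@N_ge_half _ _ _ (sum0_hyperplane R d) (root_polytope R d) root_normal root_center
  opp) => //.
- by rewrite /sum0_hyperplane /= big1// => i _; rewrite mxE.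
- move=> y z t y0 z0; rewrite /sum0_hyperplane /=.
  under eq_bigr do rewrite !mxE.
  by rewrite big_split /= -mulr_sumr y0 z0 mulr0 addr0.
- exact: root_polytopeE.
- move=> S; apply/root_polytopeE; split=> [|T]; first exact: root_center_sum0.
  by have [->|/root_center_lt1/ltW//] := eqVneq T S; rewrite root_center_eq1.
- exact: root_center_eq1.
- exact: root_center_lt1.
- by move=> S; apply/val_inj/ffunP => i; rewrite !ffunE negbK.
- move=> y S y0; apply/eqP; rewrite -addr_eq0 !ip_root_normal -big_split /= -[X in _ == X]y0.
  by apply/eqP/eq_bigr => i _; rewrite /ind ffunE; case: (val S i) => /=; ring.
- by move=> F [fF _]; exact: face_conv_neq0 finA A0 fF.
Qed.

End RootPolytope.

(** * Cubes *)

Section AffineDimension.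
Set Implicit Arguments.
Unset Strict Implicit.
Unset Printing Implicit Defensive.
Context {R : realType} {d : nat}.
Implicit Types (A P F V : set 'rV[R]_d) (u : 'cV[R]_d).

Lemma aff_independent_hyperplane (p : 'I_d.+1 -> 'rV[R]_d) u M :
  aff_independent p -> (forall i, ip (p i) u = M) -> u = 0.
Proof.
rewrite /aff_independent row_free_unit => unitp pM.
suff pu0 : (\matrix_(i < d) (p (lift ord0 i) - p ord0)) *m u = 0.
  by rewrite -[u](mulKmx unitp) pu0 mulmx0.
apply/matrixP => i j; rewrite ord1 [RHS]mxE.
have -> : 0 = ip (p (lift ord0 i) - p ord0) u by rewrite !ipl !pM subrr.
by rewrite -ipmx -[in RHS](rowK (fun i => p (lift ord0 i) - p ord0) i) -row_mul [RHS]mxE.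
Qed.

Lemma affdim_ge A k (p : 'I_k.+1 -> 'rV[R]_d) : (k <= d)%N ->
  (forall i, A (p i)) -> aff_independent p -> (k <= affdim A)%N.
Proof.
move=> kd Ap indp; rewrite /affdim.
by apply: (@leq_bigmax_cond _ _ _ (Ordinal (kd : (k < d.+1)%N))); apply/asboolP; exists p.
Qed.

Lemma affdim_le A : (affdim A <= d)%N.
Proof. by apply/bigmax_leqP => i _; rewrite -ltnS. Qed.

(** In dimension 0 the value 0 could be the default of an empty maximum, whence [0 < d]. *)
Lemma affdim_full A : (0 < d)%N -> affdim A = d -> exists p : 'I_d.+1 -> 'rV[R]_d,
  (forall i, A (p i)) /\ aff_independent p.
Proof.
move=> d0 Ad; apply: contrapT => nex.
suff : (affdim A <= d.-1)%N by rewrite Ad; case: d d0 => // n _; rewrite ltnn.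
apply/bigmax_leqP => k /asboolP kP; have := ltn_ord k; rewrite ltnS leq_eqVlt.
case/orP => [/eqP kd|]; last by move=> kd; rewrite -ltnS prednK.
have kmax : k = ord_max by exact: val_inj.
by case: nex; rewrite kmax in kP.
Qed.

Lemma affdim_lt A u M : (0 < d)%N -> u != 0 -> (forall x, A x -> ip x u = M) ->
  (affdim A < d)%N.
Proof.
move=> d0 u0 AM; rewrite ltn_neqAle affdim_le andbT; apply/eqP => /(affdim_full d0)[p [Ap indp]].
by move/eqP: u0; apply; apply: aff_independent_hyperplane indp _ => i; exact: AM.
Qed.

(** The form in which general position is used throughout: [w] is chosen so that some facet cell,
    nonempty at [c], is empty at [c + e *: w] for every positive [e]. *)
Lemma general_position_perturb V P c w : general_position V P c ->
  (forall e, V (c + e *: w)) -> exists2 e : R, 0 < e & bis_equiv V P 0 c 0 (c + e *: w).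
Proof.
rewrite /general_position near_withinE => /nbhs_ballP[r /= r0 rP] Vw.
have [j _//|e e0 eP] := @small_multiple _ _ (index_enum 'I_d) (fun=> r) (fun i => `|w 0 i|).
exists e => //; apply: rP => //; split=> // i j; rewrite ord1 !mxE -ball_normE /=.
by rewrite opprD addrA subrr sub0r normrN normrM gtr0_norm// eP// mem_index_enum.
Qed.

Lemma bis_cell_neq0 V P F G a : centrally_symmetric P -> segment_closed P ->
  proper_face P F -> proper_face P G -> F !=set0 -> G !=set0 ->
  bis_cell V P F G 0 a !=set0 <-> exists t p q,
  [/\ V (t *: p), 0 <= t, F p, G q & a = t *: (p - q)].
Proof.
move=> symP cP pF pG F0 G0; split=> [[x /bis_cellP]|[t [p [q [Vtp t0 Fp Gq aE]]]]].
  case=> // Vx [t [p [q [t0 Fp Gq xE xaE]]]]; exists t, p, q; split=> //; first by rewrite -xE.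
  by rewrite scalerBr -xE -xaE opprB addrC subrK.
exists (t *: p); apply/bis_cellP => //; split=> //; exists t, p, q; split=> //.
by rewrite aE scalerBr opprB addrC subrK.
Qed.

End AffineDimension.

(** * The cube as an intersection of half-spaces *)

Section Cube.
Set Implicit Arguments.
Unset Strict Implicit.
Unset Printing Implicit Defensive.
Context {R : realType} {d : nat}.
Hypothesis d_gt0 : (0 < d)%N.
Notation I := ('I_d * bool)%type.
Notation C := (cube R d).

Definition sg (b : bool) : R := if b then 1 else -1.
Definition cube_normal (j : I) : 'cV[R]_d := sg j.2 *: delta_mx j.1 0.
Definition cube_center (j : I) : 'rV[R]_d := sg j.2 *: stdb R j.1.
Definition cube_opp (j : I) : I := (j.1, ~~ j.2).

Lemma ip_cube_normal y i b : ip y (cube_normal (i, b)) = sg b * y 0 i.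
Proof. by rewrite ipr /= -ipmx -colE mxE. Qed.

Lemma bool_in01 (b : bool) : -1 <= (b%:R : R) <= 1.
Proof. by case: b; rewrite /= ?mulr1n ?mulr0n; apply/andP; split; lra. Qed.

Lemma sgK b : sg b * sg b = 1.
Proof. by rewrite /sg; case: b; ring. Qed.

Lemma sgN b : sg (~~ b) = - sg b.
Proof. by rewrite /sg; case: b; ring. Qed.

Lemma ip_cube_center i b k c :
  ip (cube_center (i, b)) (cube_normal (k, c)) = sg c * sg b * (k == i)%:R.
Proof. by rewrite ip_cube_normal /cube_center /stdb !mxE eqxx /= mulrA. Qed.

Lemma cubeE y : C y <-> [set: 'rV[R]_d] y /\ forall j, ip y (cube_normal j) <= 1.
Proof.
split=> [Cy|[_ Cy] i].
  split=> // -[i b]; rewrite ip_cube_normal /sg; have /andP[] := Cy i; case: b; lra.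
have := Cy (i, true); have := Cy (i, false); rewrite !ip_cube_normal /sg; lra.
Qed.

Lemma cube_center_eq1 j : ip (cube_center j) (cube_normal j) = 1.
Proof. by case: j => i b; rewrite ip_cube_center sgK eqxx mulr1. Qed.

Lemma cube_center_lt1 j k : k != j -> ip (cube_center j) (cube_normal k) < 1.
Proof.
case: j k => [i b] [k c]; rewrite xpair_eqE ip_cube_center.
by case: eqP => _; case: b; case: c => //= _; rewrite /sg; lra.
Qed.

Lemma cube_center_in j : C (cube_center j).
Proof.
apply/cubeE; split=> // k.
by have [->|/cube_center_lt1/ltW//] := eqVneq k j; rewrite cube_center_eq1.
Qed.

Lemma cube_oppK : involutive cube_opp.
Proof. by case=> i b; rewrite /cube_opp /= negbK. Qed.

Lemma cube_normal_opp (y : 'rV[R]_d) j : [set: 'rV[R]_d] y ->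
  ip y (cube_normal (cube_opp j)) = - ip y (cube_normal j).
Proof. by case: j => i b _; rewrite !ip_cube_normal sgN mulNr. Qed.

Notation F := (hface C cube_normal).

Let TD (y z : 'rV[R]_d) (t : R) : setT y -> setT z -> setT (t *: y + z). Proof. by []. Qed.
Let T0 : [set: 'rV[R]_d] 0. Proof. by []. Qed.

Lemma cube_segment_closed : segment_closed C.
Proof. exact: hpoly_segment_closed T0 TD cubeE. Qed.

Lemma cube_sym : centrally_symmetric C.
Proof. exact: hpoly_sym T0 TD cubeE cube_oppK cube_normal_opp. Qed.

Lemma cube_face_proper j : proper_face C (F j).
Proof. exact: hface_proper T0 cubeE cube_center_in cube_center_eq1 j. Qed.

Lemma cube_face_neq0 j : F j !=set0.
Proof.
by exists (cube_center j); split; [exact: cube_center_in|exact: cube_center_eq1].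
Qed.

Lemma cube_proper_face_neq0 G : proper_face C G -> G !=set0.
Proof.
(* The vertex whose signs are those of [u] maximizes [u]. *)
case=> /faceP[u ->] _; exists (\row_i sg (0 <= u i 0)); split=> [i|y Cy].
  by rewrite mxE /sg; case: ifP => _; lra.
rewrite !ipE; apply: ler_sum => i _; rewrite mxE /sg; have /andP[y1 y2] := Cy i.
by have [u0|u0] := leP 0 (u i 0) => /=; rewrite ?mul1r ?mulN1r; nra.
Qed.

Lemma affdim_cube : affdim C = d.
Proof.
apply/eqP; rewrite eqn_leq affdim_le /=.
apply: (@affdim_ge _ _ _ _ (fun k => if unlift ord0 k is Some i then stdb R i else 0)) => //.
  move=> k; case: unliftP => [i _|_] j; rewrite /stdb !mxE; first exact: bool_in01.
  exact: (bool_in01 false).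
rewrite /aff_independent (_ : \matrix_i _ = 1%:M) ?row_free_unit ?unitmx1//.
by apply/matrixP => i j; rewrite mxE liftK unlift_none subr0 /stdb !mxE eqxx eq_sym.
Qed.

(** General position speaks of facets, which are defined by dimension. The independent points are
    the centre of the facet and its translates by the other basis vectors. *)
Lemma affdim_cube_face j : (affdim (F j)).+1 = d.
Proof.
case: j => i b; apply/eqP; rewrite eqn_leq; apply/andP; split.
  apply: (@affdim_lt _ _ _ (cube_normal (i, b)) 1) => //; last by move=> x [].
  apply/eqP => e; have := cube_center_eq1 (i, b); rewrite e -ipmx mulmx0 mxE.
  by move/esym/eqP; rewrite oner_eq0.
rewrite -add1n -leq_subLR subn1.
pose p (k : 'I_d.-1.+1) := sg b *: stdb R i +
  (if unlift ord0 k is Some j then stdb R (lift i j) else 0).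
have pE k l : p k 0 l = sg b * (l == i)%:R +
    (if unlift ord0 k is Some j then (l == lift i j)%:R else 0).
  by rewrite /p !mxE; case: unlift => [j|]; rewrite !mxE eqxx.
apply: (@affdim_ge _ _ _ _ p); first exact: leq_pred.
  move=> k; split; last first.
    rewrite ip_cube_normal pE eqxx mulr1 /=; case: unlift => [j|]; last by rewrite addr0 sgK.
    by rewrite (negPf (neq_lift _ _)) addr0 sgK.
  move=> l; rewrite pE; case: unlift => [j|]; last first.
    rewrite addr0; have [_|_] := eqVneq l i; rewrite /= ?mulr1n ?mulr0n /sg.
      by case: (b); apply/andP; split; lra.
    by case: (b); apply/andP; split; lra.
  have [->|li] := eqVneq l i.
     rewrite (negPf (neq_lift _ _)) /= mulr1n mulr0n /sg.
    by case: (b); apply/andP; split; lra.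
  by rewrite mulr0 add0r bool_in01.
rewrite /aff_independent; apply/row_freeP.
exists (\matrix_(l < d, j < d.-1) (l == lift i j)%:R); apply/matrixP => j k.
have diff l : (p (lift ord0 j) - p ord0) 0 l = (l == lift i j)%:R.
  by rewrite [LHS]mxE [X in _ + X]mxE !pE liftK unlift_none addr0 addrAC subrr add0r.
rewrite !mxE (bigD1 (lift i j))//= big1 => [|l lj].
  by rewrite mxE diff mxE eqxx mul1r addr0 (inj_eq lift_inj).
by rewrite mxE diff (negPf lj) mul0r.
Qed.

Lemma cube_facet j : facet C (F j).
Proof.
by split; [case: (cube_face_proper j)|rewrite affdim_cube_face affdim_cube].
Qed.

Lemma cube_facet_cell_neq0 j k (a : 'rV[R]_d) :
  bis_cell setT C (F j) (F k) 0 a !=set0 <-> exists t p q,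
  [/\ 0 <= t, F j p, F k q & a = t *: (p - q)].
Proof.
have H := bis_cell_neq0 setT a cube_sym cube_segment_closed (cube_face_proper j)
  (cube_face_proper k) (cube_face_neq0 j) (cube_face_neq0 k).
by split=> [/H[t [p [q [_ ? ? ? ?]]]]|[t [p [q [? ? ? ?]]]]]; [|apply/H]; exists t, p, q.
Qed.

(** * General position with respect to the cube *)

Section Generic.
Variable a : 'rV[R]_d.
Hypothesis gen : general_position setT C a.

Let s i : bool := 0 <= a 0 i.
Let al i : R := ip a (cube_normal (i, s i)).

Let perturb w : exists2 e : R, 0 < e & bis_equiv setT C 0 a 0 (a + e *: w).
Proof. exact: general_position_perturb gen _. Qed.

Lemma alE i : al i = `|a 0 i|.
Proof.
by rewrite /al ip_cube_normal /sg /s; case: ger0P => _; rewrite ?mul1r ?mulN1r.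
Qed.

Lemma aE i : a 0 i = sg (s i) * al i.
Proof. by rewrite /al ip_cube_normal mulrA sgK mul1r. Qed.

(** If coordinate [i] of [a] were 0, the cell of [F (i, true)] with itself would be nonempty; but
    its points force coordinate [i] to vanish, which fails after a step along the basis vector
    [i]. *)
Lemma generic_coord_gt0 i : 0 < al i.
Proof.
rewrite alE normr_gt0; apply/eqP => ai0.
have [e e0 /(_ (F (i, true)) (F (i, true)) (cube_facet _) (cube_facet _))[h _]] :=
  perturb (stdb R i).
have /h/cube_facet_cell_neq0[t [p [q [t0 [_ p1] [_ q1] aeq]]]] :
    bis_cell setT C (F (i, true)) (F (i, true)) 0 a !=set0.
  pose t := 1 + \sum_k `|a 0 k|.
  have at_ k : `|a 0 k| <= t.
    by rewrite /t (bigD1 k)//= addrCA lerDl addr_ge0// sumr_ge0.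
  have t0 : 0 < t by rewrite ltr_pwDl// sumr_ge0.
  pose p : 'rV[R]_d := \row_k (if k == i then 1 else a 0 k / t).
  pose q : 'rV[R]_d := \row_k (if k == i then 1 else 0).
  apply/cube_facet_cell_neq0; exists t, p, q; split.
  - exact: ltW.
  - split=> [k|]; last by rewrite ip_cube_normal mxE eqxx mulr1.
    rewrite mxE; case: eqP => _; first by lra.
    by rewrite -ler_norml normrM normfV (gtr0_norm t0) ler_pdivrMr// mul1r.
  - by split=> [k|]; rewrite ?ip_cube_normal mxE ?eqxx ?mulr1//; case: eqP => _; lra.
  apply/rowP => k; rewrite !mxE; case: eqP => [->|_]; first by rewrite ai0; ring.
  by field; rewrite gt_eqF.
have /eqP := congr1 (fun x : 'rV[R]_d => ip x (cube_normal (i, true))) aeq.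
rewrite !ipl p1 q1 subrr mulr0 !ip_cube_normal ai0 /stdb mxE !eqxx /=.
by rewrite /sg mulr0 add0r !mulr1 gt_eqF.
Qed.

(** Opposite facets in direction [i] force [al i = 2 * t], and then every coordinate is at most
    [al i] in modulus. In case of a tie, raising coordinate [j] alone empties their cell. *)
Lemma generic_max_unique i j : (forall k, al k <= al i) -> j != i -> al j < al i.
Proof.
move=> imax ji; rewrite lt_neqAle imax andbT; apply/eqP => eij.
have ai0 := generic_coord_gt0 i.
have [w wi wj] : exists2 w, ip w (cube_normal (i, s i)) = 0 & ip w (cube_normal (j, s j)) = 1.
  exists (cube_center (j, s j)); rewrite ?cube_center_eq1// ip_cube_center.
  by rewrite eq_sym (negPf ji) mulr0.
have [e e0 /(_ (F (i, s i)) (F (i, ~~ s i)) (cube_facet _) (cube_facet _))[h _]] :=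
  perturb w.
have /h/cube_facet_cell_neq0[t [p [q [t0 [Cp p1] [Cq q1] aeq]]]] :
    bis_cell setT C (F (i, s i)) (F (i, ~~ s i)) 0 a !=set0.
  pose p : 'rV[R]_d := (al i)^-1 *: a.
  have Cp : C p.
    move=> k; rewrite mxE -ler_norml normrM normfV (gtr0_norm ai0) mulrC.
    by rewrite ler_pdivrMr// mul1r -alE.
  have pi1 : ip p (cube_normal (i, s i)) = 1 by rewrite ipl mulVf// gt_eqF.
  apply/cube_facet_cell_neq0; exists (al i / 2), p, (- p); split.
  - by rewrite divr_ge0 ?ltW.
  - by [].
  - split; first exact: symmN cube_sym Cp.
    by rewrite -[(i, ~~ s i)]/(cube_opp (i, s i)) cube_normal_opp// ipl opprK.
  by apply/rowP => k; rewrite /p !mxE; field; rewrite gt_eqF.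
have qi : ip q (cube_normal (i, s i)) = -1.
  by rewrite -[(i, s i)]cube_oppK cube_normal_opp// q1.
have := congr1 (fun x : 'rV[R]_d => ip x (cube_normal (i, s i))) aeq.
have := congr1 (fun x : 'rV[R]_d => ip x (cube_normal (j, s j))) aeq.
rewrite !ipl p1 qi wi wj -/(al i) -/(al j) eij.
have /cubeE[_ /(_ (j, s j)) p2] := Cp.
have /cubeE[_ /(_ (cube_opp (j, s j)))] := Cq; rewrite cube_normal_opp// => q2.
rewrite !mulr0 addr0 mulr1 => e1 e2.
suff : t * (ip p (cube_normal (j, s j)) - ip q (cube_normal (j, s j))) <= t * (1 - -1) by lra.
by rewrite ler_wpM2l//; lra.
Qed.

Definition cube_pair m := {ij : 'I_d * 'I_d | (ij.1 != ij.2) || (ij.1 == m) && (ij.2 == m)}.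

(** The complement is the diagonal without [(m, m)], of size [d - 1]. *)
Lemma card_cube_pair m : #|{: cube_pair m}| = (d ^ 2 - d + 1)%N.
Proof using d_gt0.
rewrite card_sig.
pose Q := [pred ij : 'I_d * 'I_d | (ij.1 != ij.2) || (ij.1 == m) && (ij.2 == m)].
have cC : #|predC Q| = d.-1.
  rewrite -[d in RHS]card_ord -(cardC1 m).
  have injf : injective (fun i : 'I_d => (i, i)) by move=> i j [].
  rewrite -(fintype.card_image injf).
  apply: eq_card => -[i j]; rewrite !inE /= negb_or negbK; apply/idP/fintype.imageP.
    by move=> /andP[/eqP<-]; rewrite andbb => im; exists i.
  by case=> k; rewrite inE => km [-> ->]; rewrite eqxx andbb.
have := cardC Q; rewrite cC card_prod !card_ord -/Q => e.
have dd : (d <= d * d)%N by rewrite leq_pmulr.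
have -> : (d ^ 2 = d * d)%N by rewrite mulnn.
rewrite -e -[X in (_ - X)%N](prednK d_gt0) -addn1 subnDA addnK subnK//.
by rewrite -(leq_add2r d.-1) e; case: d d_gt0 dd => // n _; rewrite add1n.
Qed.

(* In coordinates relative to the signs of [a], the facet of [p] is the only
   [k] with [r k = 1] and that of [p - t^-1 *: a] the only [k] with
   [r k - al k / t = -1]. *)
Lemma cube_pair_point m ij : (forall k, k != m -> al k < al m) ->
  (ij.1 != ij.2) || (ij.1 == m) && (ij.2 == m) ->
  exists t p q, [/\ 0 < t, F (ij.1, s ij.1) p, F (ij.2, ~~ s ij.2) q, a = t *: (p - q)
    & forall k, (F (k, s k) p -> k = ij.1) /\ (F (k, ~~ s k) q -> k = ij.2)].
Proof.
case: ij => i j /= mmax Qij.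
suff [t [r [t0 r1 ri rj]]] : exists t (r : 'I_d -> R), [/\ 0 < t,
    forall k, r k <= 1 /\ -1 <= r k - al k / t,
    forall k, r k = 1 <-> k = i & forall k, r k - al k / t = -1 <-> k = j].
  pose p : 'rV[R]_d := \row_k (sg (s k) * r k).
  pose q : 'rV[R]_d := \row_k (sg (s k) * (r k - al k / t)).
  have alt k : 0 < al k / t by rewrite divr_gt0 ?generic_coord_gt0.
  have pk k : ip p (cube_normal (k, s k)) = r k by rewrite ip_cube_normal mxE mulrA sgK mul1r.
  have qk k : ip q (cube_normal (k, ~~ s k)) = - (r k - al k / t).
    by rewrite ip_cube_normal mxE sgN mulNr mulrA sgK mul1r.
  have in01 x b : -1 <= x <= 1 -> -1 <= sg b * x <= 1.
    by rewrite /sg; case: b => /andP[x1 x2]; apply/andP; split; lra.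
  have Cp : C p.
    by move=> k; rewrite mxE; apply: in01; have [h1 h2] := r1 k; have := alt k; lra.
  have Cq : C q.
    by move=> k; rewrite mxE; apply: in01; have [h1 h2] := r1 k; have := alt k; lra.
  exists t, p, q; split=> //.
  - by split; rewrite // pk; apply/ri.
  - by split; rewrite // qk (rj j).2 ?opprK.
  - by apply/rowP => k; rewrite !mxE aE; field; rewrite gt_eqF.
  move=> k; split=> -[_]; rewrite ?pk ?qk; first by move/ri.
  by move=> e; apply/rj; rewrite -e opprK.
have alpos := generic_coord_gt0.
case: (eqVneq i j) Qij => [<- /= /andP[/eqP-> _]|ij _].
  (* The line through the centre: [p] is [a] divided by its largest modulus, and [q = - p]. *)
  have am := alpos m; exists (al m / 2), (fun k => al k / al m).
  have kE k : al k / al m - al k / (al m / 2) = - (al k / al m).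
    by field; rewrite gt_eqF.
  have mE : al m / al m = 1 by rewrite divff// gt_eqF.
  have lt1 k : k != m -> al k / al m < 1 by move=> km; rewrite ltr_pdivrMr// mul1r mmax.
  have le1 k : al k / al m <= 1 by have [->|/lt1/ltW//] := eqVneq k m; rewrite mE.
  split=> [|k|k|k]; first by rewrite divr_gt0.
  - by rewrite kE lerN2; split.
  - by split=> [e|->//]; apply/eqP; apply: contra_eqT e => /lt1/lt_eqF->.
  rewrite kE; split=> [/oppr_inj e|->]; last by rewrite mE.
  by apply/eqP; apply: contra_eqT e => /lt1/lt_eqF->.
(* With [t] this large every step [al k / t] is below 1, so the entry and exit coordinates can be
   set independently; the others are centred, which keeps both ends strictly inside. *)
pose t := 1 + \sum_k al k.
have at_ k : al k < t.
  rewrite /t (bigD1 k)//= addrCA ltrDl ltr_pwDl// sumr_ge0// => l _; exact: ltW.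
have t0 : 0 < t by rewrite ltr_pwDl// sumr_ge0// => l _; exact: ltW.
exists t, (fun k => if k == i then 1 else if k == j then -1 + al k / t else al k / t / 2).
have b0 k : 0 < al k / t by rewrite divr_gt0.
have b1 k : al k / t < 1 by rewrite ltr_pdivrMr// mul1r.
split=> // k; have := b0 k; have := b1 k; move: (al k / t) => b hb1 hb0.
- by case: eqP => _; [|case: eqP => _]; split; lra.
- case: eqP => [->//|ki]; split=> // e; case: ki; exfalso; move: e.
  by case: eqP => _; lra.
case: eqP => [->|ki].
  by split=> e; [exfalso; lra|move/eqP: ij].
case: eqP => [->|kj]; first by split=> // _; ring.
by split=> // e; exfalso; lra.
Qed.

Lemma cube_N : N setT C a = (d ^ 2 - d + 1)%N.
Proof.
have [m0 mmax0] : exists m, forall k, al k <= al m.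
  have [m _ mM] := @arg_maxP _ R 'I_d (Ordinal d_gt0) xpredT al isT.
  by exists m => k; exact: mM.
have mmax k : k != m0 -> al k < al m0 by exact: generic_max_unique.
have /choice[t /choice[p /choice[q pqP]]] :=
  fun ij : cube_pair m0 => cube_pair_point mmax (valP ij).
rewrite -(card_cube_pair m0).
pose cell (ij : cube_pair m0) :=
  bis_cell setT C (F ((val ij).1, s (val ij).1)) (F ((val ij).2, ~~ s (val ij).2)) 0 a.
have cellP j k := hcellP T0 TD cubeE cube_center_in cube_center_eq1 cube_oppK
  cube_normal_opp a j k.
apply: (@N_exact _ _ _ _ _ (cube_pair m0) cell (fun ij => t ij *: p ij)).
- move=> ij; exists (F ((val ij).1, s (val ij).1)), (F ((val ij).2, ~~ s (val ij).2)).
  by split=> //; exact: cube_face_proper.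
- move=> ij; have [t0 Fp Fq aeq _] := pqP ij; apply/cellP; split=> //.
  exists (t ij), (p ij), (q ij); split=> //; first exact: ltW.
  by rewrite aeq scalerBr opprB addrC subrK.
- move=> ij kl /cellP[_ [t' [p' [q' [t'0 Fp' Fq' zE zaE]]]]].
  have [t0 Fp Fq aeq uniq_] := pqP kl.
  have [tt pp] := face_ray_inj cube_sym (cube_face_proper _) (cube_face_proper _) Fp Fp' t0 t'0 zE.
  have qq : q kl = q'.
    apply: (scalerI (lt0r_neq0 t0)); rewrite -{2}tt -zaE aeq scalerBr opprB addrC subrK//.
  apply: val_inj; move: Fp' Fq'; rewrite -pp -qq => /(uniq_ _).1 e1 /(uniq_ _).2 e2.
  by rewrite [val ij]surjective_pairing [val kl]surjective_pairing e1 e2.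
move=> D /(hcell_dom T0 TD cubeE (Ordinal d_gt0, true) cube_proper_face_neq0).
case=> -[[i b] [j c]] /= Dij.
have Qm : (m0 != m0) || (m0 == m0) && (m0 == m0) by rewrite eqxx.
have [[z /Dij/cellP[_ [r [x [y [r0 [Cx x1] [Cy y1] zE zaE]]]]]]|Demp] := pselect (D !=set0);
  last first.
  (* An empty cell lies in any member of the family. *)
  by exists (exist _ (m0, m0) Qm) => z Dz; case: Demp; exists z.
have aeq u : ip a u = r * (ip x u - ip y u).
  have -> : a = r *: x - r *: y by rewrite -zE -zaE opprB addrC subrK.
  by rewrite !ipl; ring.
have alpos := generic_coord_gt0.
have [Cx1 Cy1] : (forall k, ip x (cube_normal k) <= 1) /\ (forall k, ip y (cube_normal k) <= 1).
  by split=> k; [have /cubeE[_]:= Cx|have /cubeE[_]:= Cy]; exact.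
have opp v k e : ip v (cube_normal (k, ~~ e)) = - ip v (cube_normal (k, e)).
  exact: (cube_normal_opp (k, e)).
(* The opposite sign would give [a] a nonpositive value on its own normal [(i, s i)]. *)
have bE : b = s i.
  have [//|nb] := eqVneq b (s i); exfalso.
  have {nb}e : b = ~~ s i by move: nb; case: (b); case: (s i).
  move: x1; rewrite e opp => x1; have := Cy1 (i, ~~ s i); rewrite opp => y2.
  have := alpos i; rewrite /al aeq.
  have : r * (ip x (cube_normal (i, s i)) - ip y (cube_normal (i, s i))) <= 0.
    by rewrite mulr_ge0_le0//; lra.
  lra.
have cE : c = ~~ s j.
  have [//|nc] := eqVneq c (~~ s j); exfalso.
  have {nc}e : c = s j by move: nc; case: (c); case: (s j).
  move: y1; rewrite e => y1; have := Cx1 (j, s j) => x2.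
  have := alpos j; rewrite /al aeq.
  have : r * (ip x (cube_normal (j, s j)) - ip y (cube_normal (j, s j))) <= 0.
    by rewrite mulr_ge0_le0//; lra.
  lra.
suff Qij : (i != j) || (i == m0) && (j == m0).
  by exists (exist _ (i, j) Qij); rewrite /cell /= -bE -cE.
(* For [i = j] the two opposite facets give [al i = 2 * r], whereas [al m0 <= 2 * r]; this excludes
   [i != m0]. *)
have [ij|//] := eqVneq i j; rewrite -ij andbb /=; apply/negPn/negP => /mmax.
move: y1; rewrite cE -ij opp => y1; move: x1; rewrite bE => x1.
have := Cy1 (m0, ~~ s m0); rewrite opp => y2; have := Cx1 (m0, s m0) => x2.
rewrite /al !aeq.
have : r * (ip x (cube_normal (m0, s m0)) - ip y (cube_normal (m0, s m0))) <= r * 2.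
  by rewrite ler_wpM2l//; lra.
have -> : ip x (cube_normal (i, s i)) - ip y (cube_normal (i, s i)) = 2 by lra.
lra.
Qed.

End Generic.
End Cube.

(** * Polygons *)

Section Vertices.
Set Implicit Arguments.
Unset Strict Implicit.
Unset Printing Implicit Defensive.
Context {R : realType} {d : nat}.
Implicit Types (A P F : set 'rV[R]_d) (u w h : 'cV[R]_d).

Lemma vertex_in P v : vertex P v -> P v.
Proof. by move=> /face_sub; apply. Qed.

Lemma vertex_extremal P v x y (t : R) : vertex P v -> P x -> P y -> 0 < t < 1 ->
  v = t *: x + (1 - t) *: y -> x = v.
Proof.
move=> Vv Px Py /andP[t0 t1] vE; have [u [leM FE]] := faceE Vv (erefl v).
suff : [set v] x by [].
apply/FE; split=> //; apply/eqP; rewrite eq_le leM//=.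
have e : ip v u = t * ip x u + (1 - t) * ip y u by rewrite [in LHS]vE !ipl.
have le1 : (1 - t) * ip y u <= (1 - t) * ip v u by rewrite ler_wpM2l ?leM// subr_ge0 ltW.
by rewrite -(ler_pM2l t0); lra.
Qed.

Lemma slice F h x y (c : R) : segment_closed F -> F x -> F y ->
  ip x h <= c <= ip y h -> exists2 z, F z & ip z h = c.
Proof.
move=> cF Fx Fy /andP[xc cy]; have [e|ne] := eqVneq (ip x h) (ip y h).
  by exists x => //; lra.
have lt : 0 < ip y h - ip x h by rewrite subr_gt0 lt_neqAle ne (le_trans xc).
exists (((ip y h - c) / (ip y h - ip x h)) *: x + (1 - (ip y h - c) / (ip y h - ip x h)) *: y).
  have l0 := ltW lt; apply: cF => //; apply/andP; split; first by apply: divr_ge0; lra.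
  by rewrite ler_pdivrMr//; lra.
by rewrite !ipl; field; rewrite gt_eqF.
Qed.

Lemma vertex_conv A v : finite_set A -> A !=set0 -> vertex (conv A) v -> A v.
Proof.
move=> finA A0 /faceP[u vE]; have [x Ax xM] := finite_argmax (ip^~ u) finA A0.
suff <- : x = v by [].
suff : [set v] x by [].
by rewrite vE; split; [exact: sub_conv|move=> y; exact: conv_le].
Qed.

(* For small [e > 0], [u + e *: w] is maximal exactly at the lexicographic
   maximum [v]; a single further [e] with [v] still maximal forces uniqueness
   at [e / 2]. *)
Lemma lexmax_vertex A u w : finite_set A -> A !=set0 ->
  (forall x y, ip x u = ip y u -> ip x w = ip y w -> x = y) ->
  exists v, [/\ vertex (conv A) v, forall x, conv A x -> ip x u <= ip v u &
    forall x, conv A x -> ip x u = ip v u -> ip x w <= ip v w].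
Proof.
move=> finA A0 inj.
have [v0 Av0 v0M] := finite_argmax (ip^~ u) finA A0.
have [||v [Av vu] vM] := @finite_argmax R _ (A `&` [set x | ip x u = ip v0 u]) (ip^~ w).
- exact: finite_setIl.
- by exists v0.
have {}v0M x : A x -> ip x u <= ip v u by rewrite vu; exact: v0M.
have {}vM x : A x -> ip x u = ip v u -> ip x w <= ip v w.
  by move=> Ax xu; apply: vM; split=> //=; rewrite xu.
have [s sE] := (finite_seqP A).1 finA.
have [x|e e0 eP] := @small_multiple R _ [seq x <- s | ip x u < ip v u]
  (fun x => ip v u - ip x u) (fun x => ip x w - ip v w).
  by rewrite mem_filter subr_gt0 => /andP[].
have uM x : conv A x -> ip x u <= ip v u by apply: conv_le.
have ewM x : conv A x -> ip x (u + e *: w) <= ip v (u + e *: w).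
  apply: conv_le => y Ay; have := v0M y Ay; rewrite !ipr le_eqVlt => /orP[/eqP yv|yv].
    by rewrite yv lerD2l ler_pM2l// vM.
  have : y \in [seq x <- s | ip x u < ip v u].
    by rewrite mem_filter yv /=; move: Ay; rewrite sE.
  by move/eP; rewrite mulrBr; lra.
have cv : conv A v by exact: sub_conv.
exists v; split=> // [|x Px xv]; last first.
  by have := ewM x Px; rewrite !ipr xv lerD2l ler_pM2l.
apply/faceP; exists (u + (e / 2) *: w); apply/seteqP; split=> [_ ->|x [Px xM]].
  by split=> // y Py; have := ewM y Py; have := uM y Py; rewrite !ipr; lra.
have := xM v cv; have := ewM x Px; have := uM x Px; rewrite !ipr => h1 h2 h3.
have e1 : ip x u = ip v u by lra.
apply: inj => //; apply/eqP; rewrite -(inj_eq (mulfI (lt0r_neq0 e0))); apply/eqP; lra.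
Qed.

End Vertices.

(** * Polygons in coordinates adapted to a direction *)

Section Polygons.
Set Implicit Arguments.
Unset Strict Implicit.
Unset Printing Implicit Defensive.
Context {R : realType}.
Implicit Types (x y p q v w a b : 'rV[R]_2) (h k u : 'cV[R]_2).

(** The forms [h], [k] are dual to the basis [b], [a]. In the picture [a] points upwards: [h] grows
    to the right, [k] to the top. *)
Definition frame h k a b := [/\ ip a h = 0, ip a k = 1, ip b h = 1, ip b k = 0 &
  forall x, x = ip x k *: a + ip x h *: b].

Lemma frame_inj h k a b x y : frame h k a b -> ip x h = ip y h -> ip x k = ip y k -> x = y.
Proof. by move=> [_ _ _ _ dec] eh ek; rewrite [x]dec [y]dec eh ek. Qed.

Lemma frame_ip h k a b x u : frame h k a b ->
  ip x u = ip x k * ip a u + ip x h * ip b u.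
Proof. by move=> [_ _ _ _ dec]; rewrite {1}[x]dec !ipl. Qed.

(** With [frameNh], the reflections that turn statements about top and right into those about bottom
    and left. *)
Lemma frameNk h k a b : frame h k a b -> frame h (- k) (- a) b.
Proof.
move=> [h1 h2 h3 h4 dec]; split; rewrite ?ipr ?ipl ?h1 ?h2 ?h3 ?h4 ?oppr0 ?opprK//.
by move=> x; rewrite ipr scalerN scaleNr opprK -dec.
Qed.

Lemma frameNh h k a b : frame h k a b -> frame (- h) k a (- b).
Proof.
move=> [h1 h2 h3 h4 dec]; split; rewrite ?ipr ?ipl ?h1 ?h2 ?h3 ?h4 ?oppr0 ?opprK//.
by move=> x; rewrite ipr scalerN scaleNr opprK -dec.
Qed.

Lemma ip2 x u : ip x u = x 0 0 * u 0 0 + x 0 1 * u 1 0.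
Proof.
rewrite ipE !big_ord_recl big_ord0 addr0.
by congr (_ + x 0 _ * u _ 0); apply: val_inj.
Qed.

Lemma ord2P (i : 'I_2) : i = 0 \/ i = 1.
Proof. by case: i => -[|[|//]] i; [left|right]; apply: val_inj. Qed.

(** [h] is [a] turned by a right angle; [k] and [b] are [a] and [h] divided by the squared norm of
    [a]. *)
Lemma frame_ex a : a != 0 -> exists h k b, frame h k a b.
Proof.
move=> a0; have [n nE] : exists n, (a 0 0 * a 0 0 + a 0 1 * a 0 1) * n = 1.
  exists (a 0 0 * a 0 0 + a 0 1 * a 0 1)^-1; rewrite divff//; apply: contra a0.
  rewrite -!expr2 paddr_eq0 ?sqr_ge0// !sqrf_eq0 => /andP[/eqP e0 /eqP e1].
  by apply/eqP/rowP => i; rewrite mxE; case: (ord2P i) => ->.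
pose h : 'cV[R]_2 := \col_i (if i == 0 then a 0 1 else - a 0 0).
pose k : 'cV[R]_2 := \col_i (a 0 i * n).
pose b : 'rV[R]_2 := \row_i (if i == 0 then a 0 1 * n else - a 0 0 * n).
exists h, k, b; split=> [||||x]; rewrite ?ip2.
- by rewrite !mxE /=; ring.
- by rewrite !mxE /= -nE; ring.
- by rewrite !mxE /= -nE; ring.
- by rewrite !mxE /=; ring.
apply/rowP => i; rewrite [RHS]mxE -[LHS]mulr1 -nE !mxE /=.
by case: (ord2P i) => -> /=; ring.
Qed.

Variables (A P : set 'rV[R]_2).
Hypotheses (finA : finite_set A) (PE : P = conv A) (symP : centrally_symmetric P)
  (dimP : affdim P = 2%N).

Lemma polygon_not_line u M : (forall x, P x -> ip x u = M) -> u = 0.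
Proof.
move=> PM; have [//|p [Pp indp]] := affdim_full _ dimP.
by apply: aff_independent_hyperplane indp _ => i; exact: PM.
Qed.

Lemma generators_neq0 : A !=set0.
Proof.
have [//|p [Pp _]] := affdim_full _ dimP.
by move: (Pp ord0); rewrite PE => -[[|n] [q [c [Aq _ + _]]]];
  [rewrite big_ord0 => /esym/eqP; rewrite oner_eq0|exists (q ord0)].
Qed.

Lemma polygon_segment_closed : segment_closed P.
Proof. by rewrite PE; exact: conv_segment_closed. Qed.

Lemma polygon_face_neq0 F : proper_face P F -> F !=set0.
Proof. by rewrite PE => -[/(face_conv_neq0 finA generators_neq0)]. Qed.

Lemma polygon_vertex_finite : finite_set (vertex P).
Proof.
by apply: sub_finite_set finA => v; rewrite PE; exact: vertex_conv generators_neq0.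
Qed.

Lemma polygon_lexmax (u w : 'cV[R]_2) : (forall x y, ip x u = ip y u -> ip x w = ip y w -> x = y) ->
  exists v, [/\ vertex P v, forall x, P x -> ip x u <= ip v u &
    forall x, P x -> ip x u = ip v u -> ip x w <= ip v w].
Proof. by rewrite PE; exact: lexmax_vertex generators_neq0. Qed.

Lemma polygon_facet F x y : proper_face P F -> F x -> F y -> x <> y -> facet P F.
Proof.
move=> [fF neF] Fx Fy xy; split=> //; rewrite dimP; apply/eqP; rewrite eqn_leq.
have [u [leM FE]] := faceE fF Fx; apply/andP; split.
  apply: (@affdim_lt _ _ _ u (ip x u)) => //; last by move=> z /FE[].
  apply/eqP => u0; apply: neF; apply/seteqP; split=> z; first by case/FE.
  by move=> Pz; apply/FE; rewrite u0 -!ipmx !mulmx0 !mxE.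
apply: (@affdim_ge _ _ _ 1%N (fun i : 'I_2 => if i == 0 then x else y)) => //.
  by move=> i; case: ifP.
rewrite /aff_independent /row_free rank_rV; apply/eqP.
rewrite -[RHS]/(nat_of_bool true); congr nat_of_bool.
apply/eqP => /rowP e; apply: xy; apply/rowP => i; have := e i; rewrite !mxE /=.
by move=> /eqP; rewrite subr_eq0 => /eqP.
Qed.

Section Frame.
Variables (h k : 'cV[R]_2) (a b : 'rV[R]_2).
Hypothesis hk : frame h k a b.

(** The supporting line at the top point over [c], found by two finite optimizations over generators
    in place of a separation theorem. *)
Lemma support_line (c : R) : (exists2 x, P x & ip x h < c) -> (exists2 x, P x & c < ip x h) ->
  exists p sg, [/\ P p, ip p h = c & forall x, P x -> ip x (k - sg *: h) <= ip p (k - sg *: h)].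
Proof.
move=> [x Px xc] [y Py yc].
have [l Al lc] : exists2 l, A l & ip l h < c.
  apply: contrapT => nl; move: xc; apply/negP; rewrite -leNgt -lerN2 -ipNr.
  move: Px; rewrite PE; apply: conv_le => z Az; rewrite ipNr lerN2 leNgt.
  by apply/negP => zc; apply: nl; exists z.
have [r Ar rc] : exists2 r, A r & c < ip r h.
  apply: contrapT => nr; move: yc; apply/negP; rewrite -leNgt.
  move: Py; rewrite PE; apply: conv_le => z Az; rewrite leNgt.
  by apply/negP => zc; apply: nr; exists z.
(* The value of [k] over [c] on the chord joining two generators on either side. *)
pose val (z : 'rV[R]_2 * 'rV[R]_2) :=
  ((ip z.2 h - c) * ip z.1 k + (c - ip z.1 h) * ip z.2 k) / (ip z.2 h - ip z.1 h).
have [||[l0 r0] /= [[Al0 Ar0] /= [l0c r0c]] valM] := @finite_argmax R _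
  ((A `*` A) `&` [set z | ip z.1 h <= c /\ c < ip z.2 h]) val.
- exact/finite_setIl/finite_setX.
- by exists (l, r); split=> //=; split=> //; exact: ltW.
have [||r1 [Ar1 /= r1c] slM] := @finite_argmax R _
  (A `&` [set z | c < ip z h]) (fun z => (ip z k - val (l0, r0)) / (ip z h - c)).
- exact: finite_setIl.
- by exists r.
(* [sg] is the steepest slope from the top point to a generator on the right. *)
set kap := val (l0, r0) in slM; set sg := (_ / _) in slM.
have d0 : 0 < ip r0 h - ip l0 h by lra.
pose p := ((ip r0 h - c) / (ip r0 h - ip l0 h)) *: l0
  + (1 - (ip r0 h - c) / (ip r0 h - ip l0 h)) *: r0.
have ph : ip p h = c by rewrite !ipl; field; rewrite gt_eqF.
have pk : ip p k = kap by rewrite !ipl /kap /val /=; field; rewrite gt_eqF.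
exists p, sg; split=> // [|z].
  rewrite PE; apply: conv_segment_closed; [exact: sub_conv..|].
  apply/andP; split; first by apply: divr_ge0; lra.
  by rewrite ler_pdivrMr//; lra.
rewrite PE; apply: conv_le => {}z Az; rewrite !ipr ph pk.
have d1 : 0 < ip r1 h - c by rewrite subr_gt0.
have sgE : ip r1 k = kap + sg * (ip r1 h - c).
  by rewrite /sg divfK ?gt_eqF//; ring.
have [zc|cz] := leP (ip z h) c; last first.
  have := slM z (conj Az cz); rewrite ler_pdivrMr ?subr_gt0//; lra.
(* A left generator above the line would form with [r1] a chord passing above the highest one. *)
have := valM (z, r1) (conj (conj Az Ar1) (conj zc r1c)).
rewrite -/kap /val /= ler_pdivrMr; last lra.
rewrite sgE => le1.
have : (ip r1 h - c) * (ip z k + sg * (c - ip z h)) <= (ip r1 h - c) * kap by lra.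
by rewrite ler_pM2l//; lra.
Qed.

(** The supporting line over the midpoint cuts out a face; its leftmost and rightmost points are
    vertices, so they cannot lie strictly inside the gap and the face spans it. *)
Lemma edge_over (c1 c2 : R) : c1 < c2 ->
  (forall v, vertex P v -> c1 < ip v h < c2 -> False) ->
  (exists2 x, P x & ip x h <= c1) -> (exists2 x, P x & c2 <= ip x h) ->
  exists F p1 p2 sg, [/\ proper_face P F, F p1 /\ F p2, ip p1 h = c1, ip p2 h = c2 &
    forall x y, F x -> P y -> ip y (k - sg *: h) <= ip x (k - sg *: h)].
Proof.
move=> c12 nov [x1 Px1 x1c] [x2 Px2 x2c]; pose m := (c1 + c2) / 2.
have [||p [sg [Pp pm pM]]] := support_line (c := m).
- by exists x1 => //; rewrite /m; lra.
- by exists x2 => //; rewrite /m; lra.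
pose u := k - sg *: h; pose F := [set x | P x /\ ip x u = ip p u].
have fF : face P F by apply: face_argmax Pp _ pM.
have inj s (s0 : s != 0) x y : ip x u = ip y u -> ip x (s *: h) = ip y (s *: h) -> x = y.
  rewrite !ipr => e /(mulfI s0) e'; apply: (frame_inj hk e').
  by move: e; rewrite e'; lra.
have [v [Vv vu vh]] := polygon_lexmax (inj (-1) (negbT (lt_eqF (ltrN10 R)))).
have [w [Vw wu wh]] := polygon_lexmax (inj 1 (oner_neq0 R)).
have Fv : F v.
  split; first exact: vertex_in.
  by apply/eqP; rewrite eq_le vu// pM//; exact: vertex_in.
have Fw : F w.
  split; first exact: vertex_in.
  by apply/eqP; rewrite eq_le wu// pM//; exact: vertex_in.
have vc1 : ip v h <= c1.
  rewrite leNgt; apply/negP => lt1; apply: (nov v Vv); rewrite lt1 /=.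
  have := vh p Pp; rewrite Fv.2 !ipr pm /m => /(_ erefl); lra.
have wc2 : c2 <= ip w h.
  rewrite leNgt; apply/negP => lt2; apply: (nov w Vw); rewrite lt2 andbT.
  have := wh p Pp; rewrite Fw.2 !ipr pm /m => /(_ erefl); lra.
have cF := face_segment_closed polygon_segment_closed fF.
have [|p1 Fp1 p1c] := slice (h := h) (c := c1) cF Fv Fw; first by rewrite vc1; lra.
have [|p2 Fp2 p2c] := slice (h := h) (c := c2) cF Fv Fw; first by rewrite wc2 andbT; lra.
exists F, p1, p2, sg; split=> //; last by move=> x y [Px ->] Py; exact: pM.
split=> // FP; have u0 : u = 0.
  by apply: (@polygon_not_line u (ip p u)) => x; rewrite -FP => -[].
have [ah ak _ _ _] := hk; have := congr1 (fun u => ip a u) u0.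
rewrite /u !ipr ah ak -[in RHS]ipmx mulmx0 mxE mulr0 subr0 => /eqP; rewrite oner_eq0//.
Qed.

Lemma next_vertex v w : vertex P v -> vertex P w -> ip v h < ip w h ->
  exists v', [/\ vertex P v', ip v h < ip v' h &
    forall x, vertex P x -> ip v h < ip x h < ip v' h -> False].
Proof.
move=> Vv Vw vw.
have [||v' [Vv' /= vv'] v'M] := @finite_argmax R _
  (vertex P `&` [set x | ip v h < ip x h]) (fun x => - ip x h).
- exact/finite_setIl/polygon_vertex_finite.
- by exists w.
exists v'; split=> // x Vx /andP[vx xv'].
by have := v'M x (conj Vx vx); rewrite lerN2 leNgt xv'.
Qed.

Lemma rightmost_vertex : exists2 v, vertex P v & forall x, P x -> ip x h <= ip v h.
Proof.
have [x y|v [Vv vM _]] := @polygon_lexmax h k; first exact: frame_inj hk.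
by exists v.
Qed.

(** The edge over the gap from [v] to the next vertex starts at [v]; a point of it further left
    would put [v] inside a segment. *)
Lemma right_facet v : vertex P v ->
  (forall y, P y -> ip y h = ip v h -> ip y k <= ip v k) ->
  (exists2 x, P x & ip v h < ip x h) ->
  exists2 F, facet P F & F v /\ forall x, F x -> ip v h <= ip x h.
Proof.
move=> Vv vtop [x Px vx]; have Pv := vertex_in Vv.
have [w Vw wM] := rightmost_vertex.
have [|v' [Vv' vv' nov]] := next_vertex Vv Vw; first exact: lt_le_trans (wM x Px).
have [|||F [p1 [p2 [sg [pF [Fp1 Fp2] p1h p2h supp]]]]] := edge_over vv'.
- by move=> z Vz; exact: nov.
- by exists v.
- by exists v' => //; exact: vertex_in.
have top z : F z -> ip z h = ip v h -> z = v.
  move=> Fz zv; apply: (frame_inj hk zv); apply/eqP; rewrite eq_le.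
  rewrite vtop//=; last exact: face_sub pF.1 Fz.
  by have := supp z v Fz Pv; rewrite !ipr zv; lra.
have Fv : F v by rewrite -(top p1).
exists F.
  by apply: (polygon_facet pF Fp1 Fp2) => e; move: vv'; rewrite -p1h -p2h e ltxx.
split=> // z Fz; rewrite leNgt; apply/negP => zv.
pose t := (ip p2 h - ip v h) / (ip p2 h - ip z h).
have d0 : 0 < ip p2 h - ip z h by lra.
have t01 : 0 < t < 1 by rewrite /t ltr_pdivrMr// divr_gt0//=; lra.
have Pz := face_sub pF.1 Fz; have Pp2 := face_sub pF.1 Fp2.
have vE : v = t *: z + (1 - t) *: p2.
  apply/esym/top; last by rewrite !ipl /t; field; rewrite gt_eqF.
  apply: (face_segment_closed polygon_segment_closed pF.1) => //.
  by case/andP: t01 => /ltW-> /ltW->.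
by have := vertex_extremal Vv Pz Pp2 t01 vE => zE; rewrite zE ltxx in zv.
Qed.

Lemma vertical_extremal v x y : vertex P v -> P x -> P y ->
  ip x h = ip v h -> ip y h = ip v h -> ip x k < ip v k < ip y k -> False.
Proof.
move=> Vv Px Py xv yv /andP[xk yk].
have d0 : 0 < ip y k - ip x k by lra.
have t01 : 0 < (ip y k - ip v k) / (ip y k - ip x k) < 1.
  by rewrite ltr_pdivrMr// divr_gt0//=; lra.
set t := (_ / _) in t01; have vE : v = t *: x + (1 - t) *: y.
  by apply: (frame_inj hk); rewrite !ipl ?xv ?yv /t; field; rewrite gt_eqF.
by rewrite (vertex_extremal Vv Px Py t01 vE) ltxx in xk.
Qed.

Definition heights_inj := forall v w, vertex P v -> vertex P w -> ip v h = ip w h -> v = w.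

(** Otherwise the chord lies in the extreme level of [h], whose top and bottom vertices coincide by
    [hinj], so it has length 0. *)
Lemma vertical_right p q (s : R) : heights_inj -> P p -> P q -> 0 < s ->
  p - q = s *: a -> exists2 x, P x & ip p h < ip x h.
Proof.
move=> hinj Pp Pq s0 pq; apply: contrapT => nex.
have pM x : P x -> ip x h <= ip p h.
  by move=> Px; rewrite leNgt; apply/negP => px; apply: nex; exists x.
have [x y|v [Vv vh vk]] := @polygon_lexmax h k; first exact: frame_inj hk.
have [x y|w [Vw wh wk]] := @polygon_lexmax h (- k); first exact: frame_inj (frameNk hk).
have vp : ip v h = ip p h by apply/eqP; rewrite eq_le vh// pM//; exact: vertex_in.
have wp : ip w h = ip p h by apply/eqP; rewrite eq_le wh// pM//; exact: vertex_in.
have vw : v = w by apply: hinj => //; rewrite vp wp.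
have [ah ak _ _ _] := hk.
have := congr1 (ip^~ h) pq; have := congr1 (ip^~ k) pq; rewrite /= !ipl ah ak => ek eh.
have := vk p Pp (esym vp); have := wk q Pq; rewrite -vw vp !ipr => h1 h2.
have : ip q h = ip p h by lra.
by move/h1; lra.
Qed.

Lemma facet_proper F : facet P F -> proper_face P F.
Proof.
by case=> fF dF; split=> // FP; move/eqP: dF; rewrite FP -addn1 -[X in _ == X]addn0 eqn_add2l.
Qed.

(** The side parallel to [a]: an extreme level set of [h] with two vertices on it. *)
Lemma horizontal_facet v w (c : R) : vertex P v -> vertex P w -> v <> w ->
  ip v h = c -> ip w h = c ->
  (forall x, P x -> ip x h <= c) \/ (forall x, P x -> c <= ip x h) ->
  facet P [set x | P x /\ ip x h = c].
Proof.
move=> Vv Vw vw vc wc ext; have Pv := vertex_in Vv; have Pw := vertex_in Vw.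
apply: (@polygon_facet _ v w) => //; split.
  case: ext => ext; first exact: face_argmax Pv vc ext.
  have -> : [set x | P x /\ ip x h = c] = [set x | P x /\ ip x (- h) = - c].
    by apply/seteqP; split=> x [Px] /= xc; split=> //; move: xc; rewrite ipr; lra.
  apply: face_argmax Pv _ _; first by rewrite ipr vc.
  by move=> x /ext; rewrite ipr lerN2.
move=> e; have h0 : h = 0.
  by apply: (@polygon_not_line h c) => x; rewrite -{1}e => -[].
by have [_ _ + _ _] := hk; rewrite h0 -ipmx mulmx0 mxE => /esym/eqP; rewrite oner_eq0.
Qed.

End Frame.

Section FrameTwoSided.
Variables (h k : 'cV[R]_2) (a b : 'rV[R]_2).
Hypothesis hk : frame h k a b.

(* A vertical chord between two vertices would make [a] lie on the boundary of
   the cone over [F - G] for facets [F], [G] through its endpoints on opposite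
   sides of the chord. *)
Lemma generic_heights : general_position setT P a -> heights_inj h.
Proof.
move=> gen v w; wlog kvw : v w / ip v k < ip w k.
  move=> H Vv Vw e; case: (ltgtP (ip v k) (ip w k)) => c.
  - exact: H.
  - by apply/esym; exact: H.
  - exact: frame_inj hk e c.
move=> Vv Vw e; exfalso; have Pv := vertex_in Vv; have Pw := vertex_in Vw.
have wtop y : P y -> ip y h = ip w h -> ip y k <= ip w k.
  move=> Py yw; rewrite leNgt; apply/negP => wy.
  by apply: (vertical_extremal hk Vw Pv Py) => //; rewrite kvw.
have vbot y : P y -> ip y (- h) = ip v (- h) -> ip y (- k) <= ip v (- k).
  rewrite !ipr => Py /oppr_inj yv; rewrite lerN2 leNgt; apply/negP => wy.
  by apply: (vertical_extremal hk Vv Py Pw) => //; rewrite wy.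
suff [F [G [fF fG Fw Gv hFG]]] : exists F G, [/\ facet P F, facet P G, F w, G v &
    forall x y, F x -> G y -> ip y h <= ip x h].
  have [ah ak bh bk _] := hk.
  (* Since [F] lies right of [G], differences [p - q] have nonnegative [h], whereas moving by [- b]
     makes [h] negative. *)
  have [c c0 /(_ F G fF fG)[h1 _]] := general_position_perturb gen (w := - b) (fun=> I).
  have [pF pG] := (facet_proper fF, facet_proper fG).
  have H z := bis_cell_neq0 setT z symP polygon_segment_closed pF pG
    (polygon_face_neq0 pF) (polygon_face_neq0 pG).
  have /h1/H[t [p [q [_ t0 Fp Gq aE]]]] : bis_cell setT P F G 0 a !=set0.
    apply/H; exists (ip w k - ip v k)^-1, w, v; split=> //.
      by rewrite invr_ge0 subr_ge0 ltW.
    apply: (frame_inj hk); rewrite !ipl ?ah ?ak; first by rewrite e subrr mulr0.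
    by rewrite mulVf// gt_eqF// subr_gt0.
  have := congr1 (ip^~ h) aE; rewrite /= !ipl ah bh => ch.
  have : 0 <= t * (ip p h - ip q h) by rewrite mulr_ge0// subr_ge0 hFG.
  lra.
have vw : v <> w by move=> vw; rewrite vw ltxx in kvw.
have side : (forall x, P x -> ip x h <= ip w h) \/ (forall x, P x -> ip w h <= ip x h) ->
    exists F G, [/\ facet P F, facet P G, F w, G v &
    forall x y, F x -> G y -> ip y h <= ip x h].
  move=> /(horizontal_facet hk Vv Vw vw e erefl) fE; do 2!exists [set x | P x /\ ip x h = ip w h].
  by split=> // x y [_ ->] [_ ->].
have [xr|nr] := pselect (exists2 x, P x & ip w h < ip x h); last first.
  by apply: side; left => x Px; rewrite leNgt; apply/negP => xw; apply: nr; exists x.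
have [[x Px xl]|nl] := pselect (exists2 x, P x & ip x h < ip w h); last first.
  by apply: side; right => x Px; rewrite leNgt; apply/negP => xw; apply: nl; exists x.
have [F fF [Fw hF]] := right_facet hk Vw wtop xr.
have [|G fG [Gv hG]] := right_facet (frameNh (frameNk hk)) Vv vbot.
  by exists x => //; rewrite !ipr ltrN2 e.
exists F, G; split=> // z y /hF zw /hG; rewrite !ipr lerN2 e => yw; exact: le_trans yw zw.
Qed.

Hypothesis hinj : heights_inj h.

Lemma vertical_left p q (s : R) : P p -> P q -> 0 < s ->
  p - q = s *: a -> exists2 x, P x & ip x h < ip p h.
Proof.
move=> Pp Pq s0 pq; have [|x Px xp] := vertical_right (frameNh hk) _ Pp Pq s0 pq.
  by move=> v w Vv Vw; rewrite !ipr => /oppr_inj; exact: hinj.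
by exists x => //; move: xp; rewrite !ipr ltrN2.
Qed.

(** The functional of [F] is nonnegative on [a]. If it vanished there it would be a multiple of [h],
    maximal at [p] with points of [P] on both sides, hence zero. *)
Lemma face_top F p q (s : R) : proper_face P F -> F p -> P q -> 0 < s ->
  p - q = s *: a -> forall x, P x -> ip x h = ip p h -> ip x k <= ip p k.
Proof.
move=> [fF neF] Fp Pq s0 pq x Px xp; have [u [leM FE]] := faceE fF Fp.
have Pp := face_sub fF Fp.
have au : 0 <= ip a u.
  have := leM q Pq; have := congr1 (ip^~ u) pq; rewrite /= !ipl => e le1.
  by rewrite -(pmulr_rge0 _ s0); lra.
have uE y := frame_ip y u hk.
suff au0 : ip a u != 0.
  have {au}au : 0 < ip a u by rewrite lt_def au0.
  by have := leM x Px; rewrite (uE x) (uE p) xp lerD2r ler_pM2r.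
apply/eqP => au0; have [y Py yp] := vertical_left Pp Pq s0 pq.
have [z Pz zp] := vertical_right hk hinj Pp Pq s0 pq.
have := leM y Py; have := leM z Pz; rewrite (uE y) (uE z) (uE p) au0 !mulr0 !add0r => le1 le2.
have bu0 : ip b u = 0.
  have h1 : (ip z h - ip p h) * ip b u <= 0 by lra.
  have h2 : 0 <= (ip p h - ip y h) * ip b u by lra.
  apply/eqP; rewrite eq_le; apply/andP; split.
    by move: h1; rewrite pmulr_rle0// subr_gt0.
  by move: h2; rewrite pmulr_rge0// subr_gt0.
apply: neF; apply/seteqP; split=> w; first by case/FE.
by move=> Pw; apply/FE; rewrite (uE w) (uE p) au0 bu0 !mulr0.
Qed.

End FrameTwoSided.

(** * Counting the gaps between vertex heights *)

Section Count.
Variables (h k : 'cV[R]_2) (a b : 'rV[R]_2).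
Hypotheses (hk : frame h k a b) (hinj : heights_inj h).

Lemma face_bottom G p q (s : R) : proper_face P G -> G q -> P p -> 0 < s ->
  p - q = s *: a -> forall x, P x -> ip x h = ip q h -> ip q k <= ip x k.
Proof.
move=> pG Gq Pp s0 pq x Px xq; have qp : q - p = s *: - a by rewrite scalerN -pq opprB.
by have := face_top (frameNk hk) hinj pG Gq Pp s0 qp Px xq; rewrite !ipr lerN2.
Qed.

Lemma vertical_height p q (s : R) : p - q = s *: a -> ip q h = ip p h.
Proof.
by move/(congr1 (ip^~ h)); have [ah _ _ _ _] := hk; rewrite /= !ipl ah; lra.
Qed.

(** Interpolating the two chords gives a chord from [F] to [G] through [v]. Then [v] is inside a
    segment of [F], of [G], or inside the chord itself, against extremality. *)
Lemma no_vertex_between F G p1 q1 (s1 : R) p2 q2 (s2 : R) v :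
  proper_face P F -> proper_face P G -> F p1 -> F p2 -> G q1 -> G q2 ->
  0 < s1 -> 0 < s2 -> p1 - q1 = s1 *: a -> p2 - q2 = s2 *: a ->
  vertex P v -> ip p1 h < ip v h < ip p2 h -> False.
Proof.
move=> pF pG Fp1 Fp2 Gq1 Gq2 s10 s20 pq1 pq2 Vv /andP[v1 v2].
have d0 : 0 < ip p2 h - ip p1 h by lra.
pose t := (ip p2 h - ip v h) / (ip p2 h - ip p1 h).
have t01 : 0 < t < 1 by rewrite /t ltr_pdivrMr// divr_gt0//=; lra.
have t01' : 0 <= t <= 1 by case/andP: t01 => /ltW-> /ltW->.
pose p := t *: p1 + (1 - t) *: p2; pose q := t *: q1 + (1 - t) *: q2.
have Fp : F p by apply: (face_segment_closed polygon_segment_closed pF.1).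
have Gq : G q by apply: (face_segment_closed polygon_segment_closed pG.1).
have pq : p - q = (t * s1 + (1 - t) * s2) *: a.
  by rewrite scalerDl -(scalerA t s1) -(scalerA (1 - t) s2) -pq1 -pq2 /p /q;
    apply/rowP => i; rewrite !mxE; ring.
have s0 : 0 < t * s1 + (1 - t) * s2.
  by case/andP: t01 => t0 t1; rewrite addr_gt0// mulr_gt0// subr_gt0.
have ph : ip p h = ip v h by rewrite !ipl /t; field; rewrite gt_eqF.
have qh : ip q h = ip v h by rewrite (vertical_height pq).
have [Pp Pq Pv] : [/\ P p, P q & P v].
  by split; [exact: face_sub pF.1 Fp|exact: face_sub pG.1 Gq|exact: vertex_in].
have := face_top hk hinj pF Fp Pq s0 pq Pv (esym ph).
have := face_bottom pG Gq Pp s0 pq Pv (esym qh).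
rewrite le_eqVlt => /orP[/eqP qv _|qv].
  have vq : v = q by apply: (frame_inj hk); rewrite ?qh ?qv.
  have := vertex_extremal Vv (face_sub pG.1 Gq1) (face_sub pG.1 Gq2) t01 vq.
  by move=> e; move: v1; rewrite -(vertical_height pq1) e ltxx.
rewrite le_eqVlt => /orP[/eqP vp|vp].
  have vpE : v = p by apply: (frame_inj hk); rewrite ?ph ?vp.
  have := vertex_extremal Vv (face_sub pF.1 Fp1) (face_sub pF.1 Fp2) t01 vpE.
  by move=> e; move: v1; rewrite e ltxx.
by apply: (vertical_extremal hk Vv Pq Pp qh ph); rewrite qv.
Qed.

(* [F] and [G] are the top and bottom edges over the gap, and [t *: p] is a
   bisector point over its middle. *)
Lemma gap_cell (c1 c2 : R) : c1 < c2 ->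
  (forall v, vertex P v -> c1 < ip v h < c2 -> False) ->
  (exists2 x, P x & ip x h <= c1) -> (exists2 x, P x & c2 <= ip x h) ->
  exists F G p q t, [/\ proper_face P F /\ proper_face P G, F p /\ G q,
    [/\ ip p h = (c1 + c2) / 2, 0 < t & p - q = t^-1 *: a],
    forall c, c1 <= c <= c2 -> (exists2 x, F x & ip x h = c) /\ (exists2 y, G y & ip y h = c) &
    (forall x z, F x -> P z -> ip z h = ip x h -> ip z k <= ip x k) /\
    (forall y z, G y -> P z -> ip z h = ip y h -> ip y k <= ip z k)].
Proof.
move=> c12 nov xl xr.
have [F [p1 [p2 [sF [pF [Fp1 Fp2] p1h p2h supF]]]]] := edge_over hk c12 nov xl xr.
have [G [q1 [q2 [sG [pG [Gq1 Gq2] q1h q2h supG]]]]] := edge_over (frameNk hk) c12 nov xl xr.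
have cF := face_segment_closed polygon_segment_closed pF.1.
have cG := face_segment_closed polygon_segment_closed pG.1.
have sliceF c : c1 <= c <= c2 -> exists2 x, F x & ip x h = c.
  by move=> cc; apply: slice cF Fp1 Fp2 _; rewrite p1h p2h.
have sliceG c : c1 <= c <= c2 -> exists2 x, G x & ip x h = c.
  by move=> cc; apply: slice cG Gq1 Gq2 _; rewrite q1h q2h.
have topF x z : F x -> P z -> ip z h = ip x h -> ip z k <= ip x k.
  by move=> Fx Pz zx; have := supF x z Fx Pz; rewrite !ipr zx; lra.
have botG x z : G x -> P z -> ip z h = ip x h -> ip x k <= ip z k.
  by move=> Gx Pz zx; have := supG x z Gx Pz; rewrite !ipr zx; lra.
have mid : c1 <= (c1 + c2) / 2 <= c2 by lra.
have [p Fp ph] := sliceF _ mid; have [q Gq qh] := sliceG _ mid.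
have qp : ip q k <= ip p k.
  by apply: topF => //; [exact: face_sub pG.1 Gq|rewrite qh ph].
have [ah ak bh bk dec] := hk.
have pqk : ip p k - ip q k != 0.
  rewrite subr_eq0; apply/eqP => epq.
  have supp x : P x -> ip x k - sF * ip x h <= ip p k - sF * ip p h /\
      - ip x k - sG * ip x h <= - ip p k - sG * ip p h.
    move=> Px; have := supF p x Fp Px; have := supG q x Gq Px.
    by rewrite !ipr qh ph epq; lra.
  have [[x Px xc] [y Py yc]] := (xl, xr).
  have [[x1 x2] [y1 y2]] := (supp x Px, supp y Py).
  have sz : sF + sG = 0.
    have h1 : (sF + sG) * (ip p h - ip x h) <= 0 by lra.
    have h2 : 0 <= (sF + sG) * (ip y h - ip p h) by lra.
    have [hp1 hp2] : 0 < ip p h - ip x h /\ 0 < ip y h - ip p h by rewrite ph; lra.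
    apply/eqP; rewrite eq_le; apply/andP; split.
      by move: h1; rewrite pmulr_lle0.
    by move: h2; rewrite pmulr_lge0.
  have sGE : sG = - sF by lra.
  have u0 : k - sF *: h = 0.
    apply: (@polygon_not_line _ (ip p k - sF * ip p h)) => z Pz.
    by have [] := supp z Pz; rewrite sGE !ipr; lra.
  have := congr1 (fun u => ip a u) u0; rewrite !ipr ah ak -[RHS]ipmx mulmx0 mxE.
  by rewrite mulr0 subr0 => /eqP; rewrite oner_eq0.
have s0 : 0 < ip p k - ip q k by rewrite lt_def pqk subr_ge0.
exists F, G, p, q, (ip p k - ip q k)^-1; split=> //.
  split=> //; first by rewrite invr_gt0.
  apply: (frame_inj hk); rewrite !ipl invrK ?ah ?ak ?mulr1//.
  by rewrite ph qh; lra.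
by move=> c cc; split; [exact: sliceF|exact: sliceG].
Qed.

Lemma gap_cover (f : nat -> R) (m : nat) (J : set R) : J !=set0 ->
  (forall c, J c -> f 0%N <= c <= f m.+1) ->
  (forall c c' j, J c -> J c' -> (j <= m.+1)%N -> c < f j < c' -> False) ->
  exists2 i, (i < m.+1)%N & forall c, J c -> f i <= c <= f i.+1.
Proof.
move=> [c0 Jc0] Jf nof.
have cover c c' : J c -> J c' -> c <= c' ->
    exists2 i, (i < m.+1)%N & f i <= c /\ c' <= f i.+1.
  move=> Jc Jc' cc'; have [] := @ex_maxnP (fun i => (i < m.+1)%N && (f i <= c)) m.+1.
  - by exists 0%N; have /andP[->] := Jf c Jc.
  - by move=> i /andP[/ltnW].
  move=> i /andP[im fi] imax; exists i => //; split=> //.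
  have [e|ne] := eqVneq i m; first by rewrite e; have /andP[] := Jf c' Jc'.
  have im' : (i.+1 < m.+1)%N by rewrite ltnS ltn_neqAle ne.
  rewrite leNgt; apply/negP => fc'; apply: (nof c c' i.+1) => //.
  rewrite fc' andbT ltNge; apply/negP => fc.
  by have := imax i.+1; rewrite im' fc ltnn => /(_ isT).
(* Two distinct points of [J] determine the gap; a single point may sit on a boundary, and then
   either neighbour will do. *)
have [[c [c' [Jc Jc' cc']]]|nlt] := pselect (exists c c', [/\ J c, J c' & c < c']).
  have [i im [fi fi1]] := cover c c' Jc Jc' (ltW cc').
  exists i => // z Jz; apply/andP; split; rewrite leNgt; apply/negP => lt1.
    by apply: (nof z c' i) => //; [exact: ltnW|rewrite lt1 (le_lt_trans fi)].
  by apply: (nof c z i.+1) => //; rewrite lt1 andbT (lt_le_trans cc').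
have [i im [fi fi1]] := cover c0 c0 Jc0 Jc0 (lexx _); exists i => // c Jc.
suff -> : c = c0 by rewrite fi fi1.
by case: (ltgtP c c0) => // cc; case: nlt; [exists c, c0|exists c0, c].
Qed.

Lemma polygon_count n : number_of (vertex P) = (2 * n)%N -> N setT P a = (2 * n - 1)%N.
Proof.
move=> nV.
pose hs := sort <=%O [seq ip v h | v <- fset_set (vertex P)].
have size_hs : size hs = (2 * n)%N by rewrite size_sort size_map -nV.
have hsP c : reflect (exists2 v, vertex P v & ip v h = c) (c \in hs).
  rewrite mem_sort; apply: (iffP mapP) => [[v + ->]|[v Vv <-]].
    by rewrite in_fset_set ?inE; [exists v|exact: polygon_vertex_finite].
  by exists v => //; rewrite in_fset_set ?inE//; exact: polygon_vertex_finite.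
have sorted_hs : sorted <%O hs.
  rewrite sort_lt_sorted map_inj_in_uniq ?fset_uniq// => v w.
  have finV := polygon_vertex_finite.
  by rewrite !in_fset_set// !inE; exact: hinj.
pose f i := nth 0 hs i.
have f_lt i j : (i < 2 * n)%N -> (j < 2 * n)%N -> (f i < f j) = (i < j)%N.
  by move=> ii jj; rewrite /f lt_sorted_ltn_nth// inE size_hs.
have fV i : (i < 2 * n)%N -> exists2 v, vertex P v & ip v h = f i.
  by move=> ii; apply/hsP; rewrite mem_nth// size_hs.
have Vf v : vertex P v -> exists2 i, (i < 2 * n)%N & ip v h = f i.
  move=> Vv; have hv : ip v h \in hs by apply/hsP; exists v.
  by exists (index (ip v h) hs); rewrite ?/f ?nth_index// -size_hs index_mem.
have [vr Vvr vrM] := rightmost_vertex hk.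
have [vl Vvl vlM] := rightmost_vertex (frameNh hk).
have lr : ip vl h < ip vr h.
  rewrite lt_neqAle vrM ?andbT; last exact: vertex_in.
  apply/eqP => e; have h0 : h = 0.
    apply: (@polygon_not_line h (ip vl h)) => x Px; apply/eqP.
    by rewrite eq_le {1}e vrM//=; have := vlM x Px; rewrite !ipr lerN2.
  have [_ _ + _ _] := hk; rewrite h0 -ipmx mulmx0 mxE => /esym/eqP.
  by rewrite oner_eq0.
have [il iln ilE] := Vf _ Vvl; have [ir irn irE] := Vf _ Vvr.
(* There are [m.+2] heights, hence [m.+1] gaps, from [f i] to [f i.+1]. *)
have [m mE] : exists m, (2 * n = m.+2)%N.
  have : (il < ir)%N by rewrite -f_lt// -ilE -irE.
  case: (2 * n)%N irn => [//|[|m]]; last by exists m.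
  by rewrite ltnS leqn0 => /eqP->; rewrite ltn0.
have Pf x : P x -> f 0%N <= ip x h <= f m.+1.
  move=> Px; apply/andP; split.
    apply: (@le_trans _ _ (ip vl h)); last by have := vlM x Px; rewrite !ipr lerN2.
    by rewrite ilE leNgt (f_lt il 0%N iln) ?mE.
  apply: le_trans (vrM x Px) _.
  have m1n : (m.+1 < 2 * n)%N by rewrite mE.
  by rewrite irE leNgt (f_lt _ _ m1n irn) -leqNgt -ltnS -mE.
have gap (i : 'I_m.+1) : exists F G p q t,
    [/\ proper_face P F /\ proper_face P G, F p /\ G q,
    [/\ ip p h = (f i + f i.+1) / 2, 0 < t & p - q = t^-1 *: a],
    forall c, f i <= c <= f i.+1 -> (exists2 x, F x & ip x h = c) /\ (exists2 y, G y & ip y h = c) &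
    (forall x z, F x -> P z -> ip z h = ip x h -> ip z k <= ip x k) /\
    (forall y z, G y -> P z -> ip z h = ip y h -> ip y k <= ip z k)].
  have im : (i < 2 * n)%N by rewrite mE ltnS ltnW.
  have im1 : (i.+1 < 2 * n)%N by rewrite mE !ltnS -ltnS.
  apply: gap_cell; first by rewrite f_lt.
  - move=> v /Vf[j jn ->]; rewrite !f_lt// => /andP[ij]; rewrite ltnS leqNgt ij//.
  - by have [v Vv e] := fV i im; exists v; [exact: vertex_in|rewrite e].
  - by have [v Vv e] := fV _ im1; exists v; [exact: vertex_in|rewrite e].
have {gap}/choice[F /choice[G /choice[p /choice[q /choice[t gap]]]]] := gap.
pose C (i : 'I_m.+1) := bis_cell setT P (F i) (G i) 0 a.
have cP F' G' x (pF : proper_face P F') (pG : proper_face P G') :=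
  bis_cellP setT a x symP polygon_segment_closed pF pG
    (polygon_face_neq0 pF) (polygon_face_neq0 pG).
have a0 : a <> 0.
  by move=> e; have [_ + _ _ _] := hk; rewrite e ipl => /esym/eqP; rewrite oner_eq0.
rewrite mE subn1 -[RHS](card_ord m.+1).
apply: (@N_exact _ _ setT P a _ C (fun i => t i *: p i)).
- by move=> i; have [[pF pG] _ _ _ _] := gap i; exists (F i), (G i).
- move=> i; have [[pF pG] [Fp Gq] [_ t0 pq] _ _] := gap i; apply/cP => //; split=> //.
  exists (t i), (p i), (q i); split=> //; first exact: ltW.
  have : t i *: (p i - q i) = a by rewrite pq scalerA divff ?gt_eqF// scale1r.
  by move=> <-; rewrite scalerBr opprB addrC subrK.
- move=> i j; have [[pF pG] [Fp Gq] [ph t0 pq] _ _] := gap i.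
  have [[pF' pG'] [Fp' Gq'] [ph' t0' pq'] _ _] := gap j.
  move=> /(cP _ _ _ pF pG)[_ [s [x [y [s0 Fx Gy zE zaE]]]]].
  have [tt pp] := face_ray_inj symP pF' pF Fp' Fx t0' s0 zE.
  have qq : q j = y.
    apply: (scalerI (lt0r_neq0 t0')); rewrite -[in RHS]tt -zaE.
    have : t j *: (p j - q j) = a by rewrite pq' scalerA divff ?gt_eqF// scale1r.
    by move=> <-; rewrite scalerBr opprB addrC subrK.
  move: Fx Gy; rewrite -pp -qq => Fx Gy.
  have [it0 it0'] : 0 < (t i)^-1 /\ 0 < (t j)^-1 by rewrite !invr_gt0.
  (* If the midpoints of two gaps shared a cell, a vertex height would separate them, against
     [no_vertex_between]. *)
  have fmid (l : 'I_m.+1) l' : (l < l')%N -> (l' < 2 * n)%N -> (f l + f l.+1) / 2 < f l'.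
    move=> ll l'n; have ln : (l < 2 * n)%N by exact: ltn_trans ll l'n.
    have l1n : (l.+1 < 2 * n)%N by exact: leq_ltn_trans ll l'n.
    have lt1 : f l < f l.+1 by rewrite f_lt.
    have le1 : f l.+1 <= f l' by rewrite leNgt f_lt// -leqNgt.
    lra.
  have midf (l : 'I_m.+1) l' : (l' <= l)%N -> f l' < (f l + f l.+1) / 2.
    move=> ll; have ln : (l < 2 * n)%N by rewrite mE ltnS ltnW.
    have l1n : (l.+1 < 2 * n)%N by rewrite mE !ltnS -ltnS.
    have l'n : (l' < 2 * n)%N by exact: leq_ltn_trans ll ln.
    have lt1 : f l < f l.+1 by rewrite f_lt.
    have le1 : f l' <= f l by rewrite leNgt f_lt// -leqNgt.
    lra.
  apply: val_inj; case: (ltngtP i j) => // ij; exfalso.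
    have jn : (j < 2 * n)%N by rewrite mE ltnS ltnW.
    have [v Vv vE] := fV j jn.
    apply: (no_vertex_between pF pG Fp Fx Gq Gy it0 it0' pq pq' Vv).
    by rewrite ph ph' vE fmid// midf.
  have in_ : (i < 2 * n)%N by rewrite mE ltnS ltnW.
  have [v Vv vE] := fV i in_.
  apply: (no_vertex_between pF pG Fx Fp Gy Gq it0' it0 pq' pq Vv).
  by rewrite ph ph' vE fmid// midf.
move=> D [F' [G' [pF' pG' ->]]].
(* The heights of the chords from [F'] to [G']; no vertex height separates them, so they fit in one
   gap. *)
pose J := [set c | exists x y s, [/\ F' x, G' y, 0 < s, x - y = s *: a & ip x h = c]].
have inJ z : bis_cell setT P F' G' 0 a z -> exists s x y,
    [/\ 0 < s, F' x /\ G' y, x - y = s^-1 *: a, z = s *: x & z - a = s *: y].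
  move=> /(cP _ _ _ pF' pG')[_ [s [x [y [s0 Fx Gy zE zaE]]]]].
  have aE : a = s *: (x - y) by rewrite scalerBr -zE -zaE opprB addrC subrK.
  have s1 : 0 < s.
    by rewrite lt_def s0 andbT; apply/eqP => e; apply: a0; rewrite aE e scale0r.
  by exists s, x, y; split=> //; rewrite aE scalerA mulVf ?gt_eqF// scale1r.
have [[z0 Dz0]|Demp] := pselect (bis_cell setT P F' G' 0 a !=set0); last first.
  by exists ord0 => z Dz; case: Demp; exists z.
have [|||i im iJ] := @gap_cover f m J.
- have [s [x [y [s0 [Fx Gy] xy _ _]]]] := inJ _ Dz0.
  by exists (ip x h), x, y, s^-1; split=> //; rewrite invr_gt0.
- by move=> _ [x [y [s [Fx _ _ _ <-]]]]; apply: Pf; exact: face_sub pF'.1 Fx.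
- move=> _ _ j [x [y [s [Fx Gy s0 xy <-]]]] [x' [y' [s' [Fx' Gy' s0' xy' <-]]]] jm.
  have [|v Vv vE] := fV j; first by rewrite mE.
  rewrite -vE; exact: no_vertex_between pF' pG' Fx Fx' Gy Gy' s0 s0' xy xy' Vv.
exists (Ordinal im) => z /inJ[s [x [y [s0 [Fx Gy] xy zE zaE]]]].
have [[pF pG] _ _ sl [topF botG]] := gap (Ordinal im).
have si0 : 0 < s^-1 by rewrite invr_gt0.
have Jx : J (ip x h) by exists x, y, s^-1.
have [[x' Fx' x'h] [y' Gy' y'h]] := sl _ (iJ _ Jx).
have [Px Py] : P x /\ P y by split; [exact: face_sub pF'.1 Fx|exact: face_sub pG'.1 Gy].
have [Px' Py'] : P x' /\ P y' by split; [exact: face_sub pF.1 Fx'|exact: face_sub pG.1 Gy'].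
have yh : ip y h = ip x h by exact: vertical_height xy.
(* Both are the top point of [P] over the same value of [h]; likewise [y] and [y'] at the bottom. *)
have xE : x = x'.
  apply: (frame_inj hk); rewrite ?x'h//; apply/eqP; rewrite eq_le topF ?x'h//=.
  by rewrite (face_top hk hinj pF' Fx Py si0 xy).
have yE : y = y'.
  have le1 : ip y' k <= ip y k by apply: botG; rewrite ?y'h.
  have le2 : ip y k <= ip y' k by apply: face_bottom pG' Gy Px si0 xy _ Py' _; rewrite y'h yh.
  by apply: (frame_inj hk); [rewrite y'h yh|apply/eqP; rewrite eq_le le1 le2].
apply/cP => //; split=> //; exists s, x, y; split=> //; first exact: ltW.
- by rewrite xE.
- by rewrite yE.
Qed.

End Count.

(** At [a = 0] the cell of an edge with itself contains the centre, but differences of its points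
    are killed by its functional, so a step along a basis vector not killed empties the cell. The
    frame only serves to exhibit an edge. *)
Lemma generic_neq0 a : general_position setT P a -> a != 0.
Proof.
move=> gen; apply/eqP => a0.
have e1 : delta_mx 0 0 != 0 :> 'rV[R]_2.
  by apply/eqP => /matrixP/(_ 0 0)/eqP; rewrite !mxE oner_eq0.
have [h [k [b hk]]] := frame_ex e1.
have [v Vv vM] := rightmost_vertex hk; have [w Vw wM] := rightmost_vertex (frameNh hk).
have wv : ip w h < ip v h.
  rewrite lt_neqAle vM ?andbT; last exact: vertex_in.
  apply/eqP => e; have h0 : h = 0.
    apply: (@polygon_not_line h (ip w h)) => x Px; apply/eqP.
    by rewrite eq_le {1}e vM//=; have := wM x Px; rewrite !ipr lerN2.
  have [_ _ + _ _] := hk; rewrite h0 -ipmx mulmx0 mxE => /esym/eqP.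
  by rewrite oner_eq0.
have [v' [Vv' wv' nov]] := next_vertex Vw Vv wv.
have [|||F [x [y [sg [pF [Fx Fy] xh yh _]]]]] := edge_over hk wv'.
- by move=> z Vz; exact: nov.
- by exists w => //; exact: vertex_in.
- by exists v' => //; exact: vertex_in.
have fF : facet P F.
  by apply: (polygon_facet pF Fx Fy) => e; move: wv'; rewrite -xh -yh e ltxx.
have [u [leM FE]] := faceE pF.1 Fx.
have [i ui] : exists i, u i 0 != 0.
  apply: contrapT => /forallNP nu; apply: pF.2; apply/seteqP; split=> z; first by case/FE.
  move=> Pz; apply/FE; split=> //; suff -> : u = 0 by rewrite -!ipmx !mulmx0 !mxE.
  by apply/matrixP => i j; rewrite ord1 [RHS]mxE; apply/eqP/negPn/negP; exact: nu.
have [e e0 /(_ F F fF fF)[h1 _]] := general_position_perturb gen (w := stdb R i) (fun=> I).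
have H z := bis_cell_neq0 setT z symP polygon_segment_closed pF pF
  (polygon_face_neq0 pF) (polygon_face_neq0 pF).
have /h1/H[t [p [q [_ t0 Fp Fq aE]]]] : bis_cell setT P F F 0 a !=set0.
  by apply/H; exists 0, x, x; rewrite a0 !scale0r.
have := congr1 (ip^~ u) aE; rewrite /= a0 !ipl ip_stdb.
have [[_ ->] [_ ->]] := ((FE p).1 Fp, (FE q).1 Fq).
by rewrite subrr mulr0 add0r => /eqP; rewrite mulf_eq0 (negPf ui) gt_eqF.
Qed.

Lemma polygon_N n a : number_of (vertex P) = (2 * n)%N -> general_position setT P a ->
  N setT P a = (2 * n - 1)%N.
Proof.
move=> nV gen; have [h [k [b hk]]] := frame_ex (generic_neq0 gen).
exact: polygon_count hk (generic_heights hk gen) n nV.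
Qed.

End Polygons.


Theorem theorem8p1 (R : realType) :
  [/\ (forall (n : nat) (P : set 'rV[R]_2),
         polytope P -> centrally_symmetric P -> affdim P = 2%N ->
         number_of (vertex P) = (2 * n)%N ->
         forall a : 'rV[R]_2, general_position setT P a ->
           N setT P a = (2 * n - 1)%N),
      (forall d : nat, (0 < d)%N ->
         forall a : 'rV[R]_d, general_position setT (cube R d) a ->
           N setT (cube R d) a = (d ^ 2 - d + 1)%N),
      (exists (c : R) (d0 : nat), 0 < c /\
         forall d : nat, (d0 <= d)%N ->
         forall a : 'rV[R]_d, general_position setT (cross_polytope R d) a ->
           c * 2 ^+ d <= (N setT (cross_polytope R d) a)%:R) &
      (exists (c : R) (d0 : nat), 0 < c /\
         forall d : nat, (d0 <= d)%N ->
         forall a : 'rV[R]_d, sum0_hyperplane R d a ->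
           general_position (sum0_hyperplane R d) (root_polytope R d) a ->
           c * 2 ^+ d <=
             (N (sum0_hyperplane R d) (root_polytope R d) a)%:R)].
Proof.
split.
- move=> n P [A finA PE] symP dimP nV a gen.
  exact: (polygon_N finA PE symP dimP nV gen).
- by move=> d d0 a gen; exact: cube_N.
- exists 2^-1, 1%N; split; first by rewrite invr_gt0.
  move=> d d0 a _; rewrite ler_pdivrMl// -natrX -natrM ler_nat.
  exact: cross_N_ge.
(* Doubling [2 ^ d <= 2 + 2 * N] and absorbing [4 <= 2 ^ d] leaves [2 ^ d <= 4 * N]. *)
exists 4^-1, 2%N; split; first by rewrite invr_gt0.
move=> d d1 a a0 _; rewrite ler_pdivrMl// -natrX -natrM ler_nat.
have := root_N_ge d1 a0; rewrite leq_subLR => le1.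
have le2 : (2 ^ 2 <= 2 ^ d)%N by rewrite leq_exp2l.
rewrite -(leq_add2r (2 ^ d)) addnn -mul2n (leq_trans (leq_mul (leqnn 2) le1))//.
by rewrite mulnDr mulnA addnC leq_add2l.
Qed.
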